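(* Let $x\in W$ and $\alpha\in\Phi_+$. (a) Suppose that $l(s_\alpha x)=l(x)+1$ and also that there is some $v\in W$ with $\Phi_x\cup\{\alpha\}\subseteq\Phi_v$. Then there is a minimum element (in weak order) $y=x\vee s_\alpha x$ of the set $\{z\in W\mid x\leq z,\ \alpha\in\Phi_z\}$. One has $\overline{\Phi_x\cup\{\alpha\}}=\Phi_y$ and $\Phi_{s_\alpha y}=\Phi_y\setminus\{\alpha\}=\overline{(\Phi_x\cup\Phi_{s_\alpha x})\setminus\{\alpha\}}$. In particular, $y>s_\alpha y=ys_\tau$ for some $\tau\in\Pi$. (b) Suppose that $l(s_\alpha x)=l(x)-1$. Then there is a maximum element (in weak order) $y=x\wedge s_\alpha x$ of the set $\{z\in W\mid z\leq x,\ \alpha\notin\Phi_z\}$. One has $\Phi'_y=\overline{\Phi'_x\cup\{\alpha\}}$ and $\Phi'_{s_\alpha y}=\Phi'_y\setminus\{\alpha\}=\overline{(\Phi'_x\cup\Phi'_{s_\alpha x})\setminus\{\alpha\}}$. In particular, $y<s_\alpha y=ys_\tau$ for some $\tau\in\Pi$.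
   Context: Setting: $V$ is a real vector space with a symmetric bilinear form $\langle\cdot,\cdot\rangle$ and $\Pi\subseteq V$ is a set (the simple roots, possibly infinite) such that (i) $\Pi$ is positively independent (if a finite sum $\sum_{\alpha\in\Pi}c_\alpha\alpha=0$ with all $c_\alpha\geq 0$, then all $c_\alpha=0$); (ii) $\langle\alpha,\alpha\rangle=1$ for $\alpha\in\Pi$, and $\langle\alpha,\beta\rangle\in\{-\cos(\pi/m)\mid m\in\mathbb{Z}_{\geq 2}\}\cup(-\infty,-1]$ for distinct $\alpha,\beta\in\Pi$. For $\alpha\in V$ with $\langle\alpha,\alpha\rangle=1$, let $s_\alpha(v)=v-2\langle v,\alpha\rangle\alpha$. Then $S=\{s_\alpha\mid\alpha\in\Pi\}$, $W=\langle S\rangle$ is a Coxeter group with Coxeter system $(W,S)$ and length function $l$. The root system is $\Phi=W\Pi$; the positive roots $\Phi_+$ are the roots that are non-negative real linear combinations of $\Pi$; $\Phi_-=-\Phi_+$, and $\Phi$ is the disjoint union of $\Phi_+$ and $\Phi_-$. For $z\in W$, $\Phi_z:=\Phi_+\cap z(\Phi_-)$ and $\Phi'_z:=\Phi_+\setminus\Phi_z$. The weak (right) order on $W$ is defined by $x\leq y$ iff $l(y)=l(x)+l(x^{-1}y)$ (equivalently $\Phi_x\subseteq\Phi_y$); $\vee$, $\wedge$ denote join and meet in weak order. 2-closure: a subset $\Gamma$ of $\Phi$ is closed if for all $\alpha,\beta\in\Gamma$, $\{a\alpha+b\beta\mid a,b\in\mathbb{R}_{\geq0}\}\cap\Phi\subseteq\Gamma$.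 For $\Gamma\subseteq\Phi$, $\overline{\Gamma}$ is the intersection of all closed subsets of $\Phi$ containing $\Gamma$. *)

(* Defs.v *)
From HB Require Import structures.
From mathcomp Require Import all_boot all_order all_algebra.
From mathcomp Require Import boolp classical_sets reals trigo.

Set Implicit Arguments.
Unset Strict Implicit.
Unset Printing Implicit Defensive.

Import Order.TTheory GRing.Theory Num.Theory.
Local Open Scope classical_set_scope.
Local Open Scope ring_scope.

Section GeneralLinearGroup.
Context {R : realType} (V : lmodType R).

Definition is_linear_auto (f : V -> V) : bool := `[< linear f /\ bijective f >].

Record GL := MkGL { gl_fun :> V -> V; _ : is_linear_auto gl_fun }.

HB.instance Definition _ := [isSub for gl_fun].
HB.instance Definition _ := [Choice of GL by <:].

Lemma GL_linear (x : GL) : linear x.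
Proof. by case: x => f /= /asboolP[]. Qed.

Lemma GL_bij (x : GL) : bijective x.
Proof. by case: x => f /= /asboolP[]. Qed.

Lemma GL_eqP (x y : GL) : (forall v, x v = y v) -> x = y.
Proof. by move=> xy; apply: val_inj; apply/funext. Qed.

Lemma gl_one_subproof : is_linear_auto (id : V -> V).
Proof. by apply/asboolP; split=> //; exists id. Qed.

Definition gl_one : GL := MkGL gl_one_subproof.

Lemma gl_mul_subproof (x y : GL) : is_linear_auto (x \o y).
Proof.
apply/asboolP; split; last exact: bij_comp (GL_bij x) (GL_bij y).
by move=> k u v /=; rewrite !GL_linear.
Qed.

Definition gl_mul (x y : GL) : GL := MkGL (gl_mul_subproof x y).

Lemma gl_inv_ex (x : GL) : exists y : GL, cancel x y /\ cancel y x.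
Proof.
have [g xK gK] := GL_bij x.
have gP : is_linear_auto g.
  apply/asboolP; split; last by exists x.
  by move=> k u v; rewrite -{1}[u]gK -{1}[v]gK -GL_linear xK.
by exists (MkGL gP).
Qed.

Definition gl_inv (x : GL) : GL := projT1 (cid (gl_inv_ex x)).

Lemma gl_mulA : associative gl_mul.
Proof. by move=> x y z; apply: GL_eqP. Qed.

Lemma gl_mul1g : left_id gl_one gl_mul.
Proof. by move=> x; apply: GL_eqP. Qed.

Lemma gl_mulg1 : right_id gl_one gl_mul.
Proof. by move=> x; apply: GL_eqP. Qed.

Lemma gl_mulVg : left_inverse gl_one gl_inv gl_mul.
Proof.
move=> x; apply: GL_eqP => v /=.
by rewrite /gl_inv; case: cid => y [xK _] /=; apply: xK.
Qed.

Lemma gl_mulgV : right_inverse gl_one gl_inv gl_mul.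
Proof.
move=> x; apply: GL_eqP => v /=.
by rewrite /gl_inv; case: cid => y [_ yK] /=; apply: yK.
Qed.

HB.instance Definition _ :=
  isGroup.Build GL gl_mulA gl_mul1g gl_mulg1 gl_mulVg gl_mulgV.

Lemma GL1E v : (1%g : GL) v = v.
Proof. by []. Qed.

Lemma GLME (x y : GL) v : (x * y)%g v = x (y v).
Proof. by []. Qed.

End GeneralLinearGroup.

Section Groups.
Context {G : groupType}.

Definition subgroup : set (set G) :=
  [set H | H 1%g /\ forall x y, H x -> H y -> H (x * y^-1)%g].

Definition generated (S : set G) : set G := smallest subgroup S.

Definition has_word (S : set G) (w : G) (n : nat) : Prop :=
  exists s : seq G,
    [/\ size s = n, forall t, t \in s -> S t & w = (\big[*%g/1]_(t <- s) t)%g].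

(* The default value 0 is only used when [w] is not a product of elements of
   [S].  Inverses are not allowed in words: below, [S] consists of
   involutions. *)
Definition word_length (S : set G) (w : G) : nat :=
  xget 0%N [set n | has_word S w n /\ forall m, has_word S w m -> (n <= m)%N].

End Groups.

Section RootSystem.
Context {R : realType} {V : lmodType R}.
Variables (B : {symmetric V}) (Pi : set V).

Definition positively_independent : Prop :=
  forall (s : seq V) (c : V -> R),
    uniq s -> (forall b, b \in s -> Pi b /\ 0 <= c b) ->
    \sum_(b <- s) c b *: b = 0 -> forall b, b \in s -> c b = 0.

Definition simple_system : Prop :=
  [/\ positively_independent,
      forall a, Pi a -> B a a = 1
    & forall a b, Pi a -> Pi b -> a <> b ->
        (exists2 m : nat, (2 <= m)%N & B a b = - cos (pi / m%:R))
        \/ B a b <= -1].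

(* Only meaningful when [B a a = 1] (see [reflE]); [insubd] returns 1 when the
   formula does not define an invertible map. *)
Definition refl (a : V) : GL V :=
  insubd (1%g : GL V) (fun v => v - (2 * B v a) *: a).

Lemma reflE (a v : V) : B a a = 1 -> refl a v = v - (2 * B v a) *: a.
Proof.
move=> aa; rewrite /refl -[LHS]/(val (insubd _ _) v) val_insubd.
set f := fun v => _; suff -> : is_linear_auto f by [].
have ff : involutive f.
  move=> u; rewrite /f linearBl linearZl_LR /= aa mulr1 -addrA -opprD -scalerDl.
  by rewrite -mulrDr addrA -mulr2n mulr_natl subrr mulr0 scale0r subr0.
apply/asboolP; split; last by exists f.
move=> k u w; rewrite /f linearPl /= mulrDr scalerDl scalerBr opprD.
by rewrite scalerA mulrCA -!addrA; congr (_ + _); rewrite addrCA.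
Qed.

Definition simple_reflections : set (GL V) := [set refl a | a in Pi].

Definition weyl : set (GL V) := generated simple_reflections.

Definition len (w : GL V) : nat := word_length simple_reflections w.

Definition root_system : set V :=
  [set v | exists2 w, weyl w & exists2 a, Pi a & v = w a].

Definition nonneg_span : set V :=
  [set v | exists (s : seq V) (c : V -> R),
     (forall b, b \in s -> Pi b /\ 0 <= c b) /\ v = \sum_(b <- s) c b *: b].

Definition pos_roots : set V := root_system `&` nonneg_span.

Definition neg_roots : set V := [set - a | a in pos_roots].

Definition inv_set (z : GL V) : set V := pos_roots `&` [set z b | b in neg_roots].

Definition coinv_set (z : GL V) : set V := pos_roots `\` inv_set z.

(* The order relation is only considered on [weyl]. *)
Definition weak_le (x y : GL V) : Prop :=
  len y = (len x + len (x^-1 * y)%g)%N.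

Definition weak_lt (x y : GL V) : Prop := weak_le x y /\ x <> y.

Definition is_minimum (A : set (GL V)) (y : GL V) : Prop :=
  A y /\ forall z, A z -> weak_le y z.

Definition is_maximum (A : set (GL V)) (y : GL V) : Prop :=
  A y /\ forall z, A z -> weak_le z y.

Definition is_join (x1 x2 y : GL V) : Prop :=
  is_minimum [set z | [/\ weyl z, weak_le x1 z & weak_le x2 z]] y.

Definition is_meet (x1 x2 y : GL V) : Prop :=
  is_maximum [set z | [/\ weyl z, weak_le z x1 & weak_le z x2]] y.

Definition closed_roots : set (set V) :=
  [set G | G `<=` root_system /\
     forall a b (s t : R), G a -> G b -> 0 <= s -> 0 <= t ->
       root_system (s *: a + t *: b) -> G (s *: a + t *: b)].

Definition root_closure (G : set V) : set V := smallest closed_roots G.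

End RootSystem.

(* Main.v *)
Require Import Defs.
From HB Require Import structures.
From mathcomp Require Import all_boot all_order all_algebra.
From mathcomp Require Import zify ring lra.
From mathcomp Require Import boolp classical_sets reals trigo.

Set Implicit Arguments.
Unset Strict Implicit.
Unset Printing Implicit Defensive.

Import Order.TTheory GRing.Theory Num.Theory.
Local Open Scope classical_set_scope.
Local Open Scope ring_scope.

(** Write [N z] for the inversion set of [z], [N' z] for its complement in the
    positive roots, [s a] for the reflection in [a], and [w = s a * x].

    The weak order is the inclusion order of the inversion sets, and every [N z]
    and every [N' z] is closed.  So the join of [x] and [w] is an element [y] whose
    inversion set is the closure of [N x] and [a], and the meet is one for which
    [N' y] is the closure of [N' x] and [a].

    Two facts make the theorem work.  First, bounded joins exist and their
    inversion sets are the expected closures ([bounded_join]); this is proved by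
    stripping common left descents, after passing through the longest element of a
    finite dihedral parabolic subgroup.  Second, when [x] and [w] differ in
    length by one, [s a] does not interchange two inversions of the longer one up
    to sign ([cover_swap]).  Hence [N w] lies in the closure of [N x] and [a], and
    dually everything below [x] that does not have the inversion [a] is below [w].

    For joins, [a] is the last inversion created on the way up from [x] to [y], so
    that [s a * y = y * s t] and [N (s a * y)] is [N y] without [a].  That the
    latter is generated by the inversions of [x] and [w] other than [a] is
    reduced to the case where [a] is simple, and then, after enlarging [x], to a
    shorter element by dividing by a prefix, for which the claim is a computation
    in a plane ([cover_join_remove]).

    For meets, the maximum [y] exists because elements below both [x] and [w] have
    joins.  The complements are infinite in general, so descents cannot be
    stripped from them.  Instead [N' y] consists of the positive roots that are
    positive on the whole interval below [y], and these are generated by the walls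
    of the interval ([walls_generate], by induction on the depth of a root as seen
    from [y]).  A wall is a root [p k] with [p] below [y] and [k] simple; if it is
    an inversion of [x], then [p * s k] is below [x], and by maximality of [y] the
    wall can only be [a].  The same argument applied to the interval below
    [s a * y] gives the generators of [N' y] without [a].

    All this rests on the fact that a root is either positive or negative
    ([cone_of_len_le]), which relates lengths to the signs of roots. *)

(** * Reflections and words *)

Section Reflections.
Context {R : realType} {V : lmodType R} {B : {symmetric V}}.
Implicit Types (u v a b : V) (x y : GL V).

HB.instance Definition _ x :=
  GRing.isLinear.Build R V V *:%R (gl_fun x) (GL_linear x).

Lemma glVK x : cancel x (x^-1)%g.
Proof. by move=> v; rewrite -GLME mulVg. Qed.

Lemma glKV x : cancel (x^-1)%g x.
Proof. by move=> v; rewrite -GLME mulgV. Qed.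

Lemma GLD x u v : x (u + v) = x u + x v.
Proof. exact: linearD. Qed.

Lemma GLN x v : x (- v) = - x v.
Proof. exact: linearN. Qed.

Lemma GLB x u v : x (u - v) = x u - x v.
Proof. exact: linearB. Qed.

Lemma GLZ x c v : x (c *: v) = c *: x v.
Proof. exact: linearZ. Qed.

Lemma bformC u v : B u v = B v u.
Proof. by rewrite hermC /= expr0 mul1r. Qed.

Lemma bformDl u v w : B (u + v) w = B u w + B v w.
Proof. exact: linearDl. Qed.

Lemma bformZl c u v : B (c *: u) v = c * B u v.
Proof. exact: linearZl_LR. Qed.

Lemma bformDr u v w : B w (u + v) = B w u + B w v.
Proof. exact: linearDr. Qed.

Lemma bformZr c u v : B v (c *: u) = c * B v u.
Proof. by rewrite bformC bformZl bformC. Qed.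

Lemma bformNl u v : B (- u) v = - B u v.
Proof. exact: linearNl. Qed.

Lemma bformNr u v : B v (- u) = - B v u.
Proof. exact: linearNr. Qed.

Definition bformE := (bformDl, bformDr, bformZl, bformZr, bformNl, bformNr).

Lemma refl_self a : B a a = 1 -> refl B a a = - a.
Proof.
move=> aa; rewrite reflE // aa mulr1 scaler_nat mulr2n opprD addrA.
by rewrite subrr sub0r.
Qed.

Lemma reflK a : B a a = 1 -> involutive (refl B a).
Proof.
move=> aa v; rewrite [LHS]reflE // reflE // !bformE aa mulr1.
rewrite -addrA -opprD -scalerDl.
by rewrite (_ : 2 * B v a + _ = 0) ?scale0r ?subr0 //; ring.
Qed.

Lemma reflM a : B a a = 1 -> (refl B a * refl B a = 1)%g.
Proof. by move=> aa; apply: GL_eqP => v; rewrite GLME reflK. Qed.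

Lemma reflV a : B a a = 1 -> ((refl B a)^-1 = refl B a)%g.
Proof. by move=> aa; rewrite (mulg1_eq (reflM aa)). Qed.

Lemma refl_isometry a u v : B a a = 1 -> B (refl B a u) (refl B a v) = B u v.
Proof. by move=> aa; rewrite !reflE // !bformE aa (bformC a v); ring. Qed.

Lemma reflN a : B a a = 1 -> refl B (- a) = refl B a.
Proof.
move=> aa; have naa : B (- a) (- a) = 1 by rewrite !bformE opprK.
by apply: GL_eqP => v; rewrite !reflE // bformNr mulrN scaleNr scalerN opprK.
Qed.

Lemma refl_conj x a : B a a = 1 -> (forall u v, B (x u) (x v) = B u v) ->
  refl B (x a) = (x * refl B a * x^-1)%g.
Proof.
move=> aa xB; have xaa : B (x a) (x a) = 1 by rewrite xB.
apply: GL_eqP => v; rewrite reflE // !GLME reflE // GLB GLZ glKV.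
by rewrite -(xB (x^-1 v)%g) glKV.
Qed.

End Reflections.

Section Words.
Context {R : realType} {V : lmodType R} {B : {symmetric V}} {Pi : set V}.
Context (hPi : simple_system B Pi).
Implicit Types (u v a b : V) (x y z w : GL V).
Local Notation S := (simple_reflections B Pi).
Local Notation W := (weyl B Pi).
Local Notation l := (len B Pi).
Local Notation s := (refl B).

Lemma simple_form1 a : Pi a -> B a a = 1.
Proof. by case: hPi => _ + _; apply. Qed.

Lemma simple_refl_inv t : S t -> (t^-1 = t)%g.
Proof. by case=> a aPi <-; exact/reflV/simple_form1. Qed.

Lemma has_word1 : has_word S 1%g 0.
Proof. by exists [::]; rewrite big_nil. Qed.

Lemma has_word_refl a : Pi a -> has_word S (s a) 1.
Proof.
move=> aPi; exists [:: s a]; split=> //; last by rewrite big_seq1.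
by move=> t; rewrite inE => /eqP ->; exists a.
Qed.

Lemma has_wordM x y m n :
  has_word S x m -> has_word S y n -> has_word S (x * y)%g (m + n).
Proof.
move=> [r [rm rS ->]] [t [tn tS ->]]; exists (r ++ t); split.
- by rewrite size_cat rm tn.
- by move=> g; rewrite mem_cat => /orP[/rS|/tS].
- by rewrite big_cat.
Qed.

Lemma has_wordV x n : has_word S x n -> has_word S (x^-1)%g n.
Proof.
move=> [r [rn rS ->]]; exists (rev r); split; first by rewrite size_rev.
  by move=> t; rewrite mem_rev => /rS.
rewrite -{1}(revK r) -prodgV big_seq [RHS]big_seq; apply: eq_bigr => t.
by rewrite mem_rev => /rS/simple_refl_inv.
Qed.

Lemma weyl_has_word w : W w -> exists n, has_word S w n.
Proof.
apply: (_ : (W `<=` [set g | exists n, has_word S g n])%classic).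
apply: smallest_sub; last first.
  by move=> _ [a aPi <-]; exists 1%N; apply: has_word_refl.
split; first by exists 0%N; apply: has_word1.
by move=> x y [m xm] [n yn]; exists (m + n)%N; apply/has_wordM/has_wordV.
Qed.

Lemma weyl1 : W 1%g.
Proof. by move=> G [[]]. Qed.

Lemma weylMV x y : W x -> W y -> W (x * y^-1)%g.
Proof. by move=> xW yW G GS; case: (GS) => -[_ +] _; apply; [apply: xW|apply: yW]. Qed.

Lemma weylV x : W x -> W (x^-1)%g.
Proof. by move=> xW; rewrite -[(x^-1)%g]mul1g; apply: weylMV weyl1 xW. Qed.

Lemma weylM x y : W x -> W y -> W (x * y)%g.
Proof. by move=> xW /weylV yW; rewrite -[y]invgK; apply: weylMV. Qed.

Lemma weyl_simple a : Pi a -> W (s a).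
Proof. by move=> aPi G [_]; apply; exists a. Qed.

Lemma len_exists w : W w ->
  has_word S w (l w) /\ forall m, has_word S w m -> (l w <= m)%N.
Proof.
move=> /weyl_has_word [n wn]; rewrite /len /word_length.
case: xgetP => [m _ //|none]; exfalso.
have wn' : exists n, `[< has_word S w n >] by exists n; apply/asboolP.
case: (ex_minnP wn') => m /asboolP wm min.
by apply: (none m); split=> // k /asboolP; apply: min.
Qed.

Lemma len_word w : W w -> has_word S w (l w).
Proof. by case/len_exists. Qed.

Lemma len_min w m : W w -> has_word S w m -> (l w <= m)%N.
Proof. by case/len_exists => _; apply. Qed.

Lemma len1 : l 1%g = 0%N.
Proof. by have := len_min weyl1 has_word1; case: (l _). Qed.

Lemma lenM x y : W x -> W y -> (l (x * y)%g <= l x + l y)%N.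
Proof.
by move=> xW yW; apply: len_min (weylM xW yW) (has_wordM _ _); apply: len_word.
Qed.

Lemma lenV x : W x -> l (x^-1)%g = l x.
Proof.
suff le y : W y -> (l (y^-1)%g <= l y)%N.
  move=> xW; apply/eqP; rewrite eqn_leq le //=.
  by rewrite -{1}[x]invgK le //; apply: weylV.
by move=> yW; apply: len_min (weylV yW) (has_wordV (len_word yW)).
Qed.

Lemma len_simple a : Pi a -> (l (s a) <= 1)%N.
Proof. by move=> aPi; apply: len_min (weyl_simple aPi) (has_word_refl aPi). Qed.

Lemma len_mulsr w a : W w -> Pi a -> (l (w * s a)%g <= (l w).+1)%N.
Proof.
move=> wW aPi; apply: leq_trans (lenM wW (weyl_simple aPi)) _.
by rewrite -addn1 leq_add2l len_simple.
Qed.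

Lemma mulgsK a : Pi a -> involutive (fun x => x * s a)%g.
Proof. by move=> aPi x; rewrite -mulgA reflM ?mulg1 //; apply: simple_form1. Qed.

Lemma mulsgK a : Pi a -> involutive (fun x => s a * x)%g.
Proof. by move=> aPi x; rewrite mulgA reflM ?mul1g //; apply: simple_form1. Qed.

Lemma len_eq0 w : W w -> l w = 0%N -> w = 1%g.
Proof.
move=> wW w0; have := len_word wW; rewrite w0 => -[r [/size0nil -> _ ->]].
by rewrite big_nil.
Qed.

Lemma right_descent w : W w -> w <> 1%g ->
  exists2 a, Pi a & l w = (l (w * s a)%g).+1.
Proof.
move=> wW w1; have [r [rw rS wE]] := len_word wW.
case/lastP: r rw rS wE => [|r t]; first by rewrite big_nil.
rewrite size_rcons => rw rS wE.
have [a aPi at_] : S t by apply: rS; rewrite mem_rcons mem_head.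
exists a => //; apply/eqP; rewrite eqn_leq; apply/andP; split.
  rewrite -{1}[w](mulgsK aPi); apply: len_mulsr => //.
  exact: weylM (weyl_simple aPi).
rewrite -rw ltnS; apply: len_min; first exact: weylM (weyl_simple aPi).
exists r; split=> //; first by move=> g gr; apply: rS; rewrite mem_rcons in_cons gr orbT.
by rewrite wE -cats1 big_cat big_seq1 -at_ mulgsK.
Qed.

Lemma left_descent w : W w -> w <> 1%g ->
  exists2 a, Pi a & l w = (l (s a * w)%g).+1.
Proof.
move=> wW w1; have wVW := weylV wW.
have [|a aPi wa] := right_descent wVW.
  by move=> wV1; apply: w1; rewrite -[w]invgK wV1 invg1.
exists a => //; rewrite -(lenV wW) wa.
rewrite -(lenV (weylM (weyl_simple aPi) wW)) invgM.
by rewrite reflV //; apply: simple_form1.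
Qed.

End Words.

(** * The cone of the simple roots *)

Section Cone.
Context {R : realType} {V : lmodType R} {B : {symmetric V}} {Pi : set V}.
Context (hPi : simple_system B Pi).
Implicit Types (u v a b : V).
Local Notation cone := (nonneg_span Pi).

Lemma simple_form_le0 a b : Pi a -> Pi b -> a <> b -> B a b <= 0.
Proof.
move=> aPi bPi ab; case: hPi => _ _ /(_ a b aPi bPi ab) [[m m2 ->]|le].
  rewrite oppr_le0 cos_ge0_pihalf //; apply/andP; split.
    apply: (@le_trans _ _ 0); first by rewrite oppr_le0 divr_ge0 ?pi_ge0.
    by rewrite divr_ge0 ?pi_ge0.
  by rewrite ler_wpM2l ?pi_ge0 // lef_pV2 ?posrE ?ltr0n ?ler_nat //; lia.
by apply: le_trans le _; rewrite lerN10.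
Qed.

Definition supported (s : seq V) (c : V -> R) : Prop :=
  [/\ uniq s, forall b, b \in s -> Pi b & forall b, 0 <= c b].

Lemma supported_subseq s t c : supported s c -> uniq t ->
    {subset s <= t} -> (forall b, b \in t -> Pi b) ->
  exists2 d, supported t d & \sum_(b <- s) c b *: b = \sum_(b <- t) d b *: b.
Proof.
move=> [us sPi c0] ut st tPi; exists (fun b => if b \in s then c b else 0).
  by split=> // b; case: ifP.
rewrite [RHS](eq_bigr (fun b => if b \in s then c b *: b else 0)); last first.
  by move=> b _; case: ifP => // _; rewrite scale0r.
rewrite -big_mkcond -big_filter; apply: perm_big; apply: uniq_perm => //.
  exact: filter_uniq.
by move=> b; rewrite mem_filter; case: (boolP (b \in s)) => // /st ->.
Qed.

Lemma supported_common (s t r : seq V) c d : supported s c -> supported t d ->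
    (forall b, b \in r -> Pi b) ->
  exists (q : seq V) e f, [/\ supported q e, supported q f, {subset r <= q},
    \sum_(b <- s) c b *: b = \sum_(b <- q) e b *: b
  & \sum_(b <- t) d b *: b = \sum_(b <- q) f b *: b].
Proof.
move=> sc td rPi; have [_ sPi _] := sc; have [_ tPi _] := td.
pose q := undup (s ++ t ++ r).
have qPi b : b \in q -> Pi b.
  by rewrite mem_undup !mem_cat => /or3P[/sPi|/tPi|/rPi].
have uq : uniq q by exact: undup_uniq.
have [|e qe ->] := supported_subseq sc uq _ qPi.
  by move=> b bs; rewrite mem_undup mem_cat bs.
have [|f qf ->] := supported_subseq td uq _ qPi.
  by move=> b bt; rewrite mem_undup !mem_cat bt orbT.
exists q, e, f; split=> // b br.
by rewrite mem_undup !mem_cat br !orbT.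
Qed.

Lemma nil_simple b : b \in [::] -> Pi b.
Proof. by []. Qed.

(** The definition of the cone allows repetitions in the list of simple roots,
    whereas positive independence speaks of lists without repetitions. *)
Lemma coneP u : cone u <->
  exists s c, supported s c /\ u = \sum_(b <- s) c b *: b.
Proof.
split=> [[s [c [sc ->]]]|[s [c [[_ sPi c0] ->]]]]; last first.
  by exists s, c; split=> // b bs; split; [exact: sPi|].
elim: s sc => [|a s IH] sc.
  by exists [::], (fun _ => 0); rewrite !big_nil.
have [|t [d [td E]]] := IH; first by move=> b bs; apply: sc; rewrite in_cons bs orbT.
have [aPi ca0] := sc a (mem_head _ _).
have aa : supported [:: a] (fun=> c a).
  by split=> // b; rewrite inE => /eqP ->.
have [q [e [f [[uq qPi e0] [_ _ f0] _ E1 E2]]]] := supported_common aa td nil_simple.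
exists q, (fun b => e b + f b); split; first by split=> // b; rewrite addr_ge0.
rewrite big_cons E E2; move: E1; rewrite big_seq1 => ->.
by rewrite -big_split; apply: eq_bigr => b _; rewrite scalerDl.
Qed.

Lemma cone_simple a : Pi a -> cone a.
Proof.
move=> aPi; exists [:: a], (fun=> 1); rewrite big_seq1 scale1r; split=> //.
by move=> b; rewrite inE => /eqP ->.
Qed.

Lemma coneZ t u : 0 <= t -> cone u -> cone (t *: u).
Proof.
move=> t0 [s [c [sc ->]]]; exists s, (fun b => t * c b); split.
  by move=> b /sc[bPi cb]; rewrite mulr_ge0.
by rewrite scaler_sumr; apply: eq_bigr => b _; rewrite scalerA.
Qed.

Lemma coneD u v : cone u -> cone v -> cone (u + v).
Proof.
move=> /coneP[s [c [sc ->]]] /coneP[t [d [td ->]]].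
have [q [e [f [[_ qPi e0] [_ _ f0] _ -> ->]]]] :=
  supported_common sc td nil_simple.
exists q, (fun b => e b + f b); split.
  by move=> b /qPi; rewrite addr_ge0.
by rewrite -big_split; apply: eq_bigr => b _; rewrite scalerDl.
Qed.

(** A simple root spans an extreme ray: it pairs non-positively with the other
    simple roots and positively with itself, so no non-negative combination of
    the others can equal a positive multiple of it. *)
Lemma cone_face a u v t : Pi a -> cone u -> cone v -> u + v = t *: a ->
  exists2 c, 0 <= c & u = c *: a.
Proof.
move=> aPi /coneP[s [c [sc ->]]] /coneP[r [d [rd ->]]].
have [|q [e [f [[uq qPi e0] [_ _ f0] aq -> -> E]]]] :=
  supported_common (r := [:: a]) sc rd _.
  by move=> b; rewrite inE => /eqP ->.
have {}aq : a \in q by apply: aq; rewrite mem_head.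
pose g b := e b + f b; have g0 b : 0 <= g b by rewrite addr_ge0.
have sumg : \sum_(b <- q) g b *: b = t *: a.
  by rewrite -E -big_split; apply: eq_bigr => b _; rewrite scalerDl.
have rest : \sum_(b <- q | b != a) g b *: b = (t - g a) *: a.
  by rewrite scalerBl -sumg (bigD1_seq a) //= addrAC subrr add0r.
have ga : t - g a <= 0.
  have -> : t - g a = B ((t - g a) *: a) a.
    by rewrite bformZl (simple_form1 hPi) // mulr1.
  rewrite -rest linear_sumlz -big_filter big_seq; apply: sumr_le0 => b.
  rewrite mem_filter => /andP[/eqP ba bq]; rewrite /= bformZl mulr_ge0_le0 //.
  exact: simple_form_le0 (qPi _ bq) aPi ba.
pose h b := if b == a then g a - t else g b.
have h0 b : b \in q -> h b = 0.
  case: hPi => indep _ _; apply: (indep q h) => //.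
    move=> d' d'q; split; first exact: qPi.
    by rewrite /h; case: eqP => // _; rewrite -oppr_le0 opprB.
  rewrite (bigD1_seq a) //= {1}/h eqxx -opprB scaleNr -rest.
  rewrite [X in _ + X](eq_bigr (fun b => g b *: b)); first by rewrite addNr.
  by move=> d' /negPf d'a; rewrite /h d'a.
exists (e a) => //; rewrite (bigD1_seq a) //= -[RHS]addr0; congr (_ + _).
rewrite -big_filter big_seq big1 // => b; rewrite mem_filter => /andP[ba bq].
have /eqP := h0 b bq; rewrite /h (negPf ba) paddr_eq0 // => /andP[/eqP -> _].
by rewrite scale0r.
Qed.

Lemma cone_pointed u : cone u -> cone (- u) -> u = 0.
Proof.
move=> /coneP[s [c [sc E]]] /coneP[r [d [rd E']]].
have [q [e [f [[uq qPi e0] [_ _ f0] _ F F']]]] :=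
  supported_common sc rd nil_simple.
rewrite E F big_seq big1 // => b bq.
suff /eqP : e b + f b = 0.
  by rewrite paddr_eq0 // => /andP[/eqP -> _]; rewrite scale0r.
case: hPi => indep _ _; apply: (indep q (fun b => e b + f b)) => //.
  by move=> b' /qPi; rewrite addr_ge0.
rewrite (eq_bigr (fun b => e b *: b + f b *: b)); last first.
  by move=> b' _; rewrite scalerDl.
by rewrite big_split /= -F -F' -E -E' subrr.
Qed.

End Cone.

(** * Positivity of roots *)

Section Chebyshev.
Context {R : realType}.
Implicit Types (c t : R) (k m : nat).

(** The Chebyshev polynomial of the second kind of degree [k - 1]. *)
Fixpoint cheb c k : R :=
  match k with
  | k'.+1 => match k' with k''.+1 => 2 * c * cheb c k' - cheb c k'' | 0 => 1 end
  | 0 => 0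
  end.

Lemma chebSS c k : cheb c k.+2 = 2 * c * cheb c k.+1 - cheb c k.
Proof. by []. Qed.

Lemma cheb_incr c k : 1 <= c -> 0 <= cheb c k <= cheb c k.+1.
Proof.
move=> c1; elim: k => [|k /andP[k0 kk]]; first by rewrite /= lexx ler01.
rewrite (le_trans k0 kk) andTb chebSS; set u := cheb c k.+1 in kk *.
have : 0 <= (c - 1) * u by rewrite mulr_ge0 ?subr_ge0 // (le_trans k0).
by rewrite mulrBl mul1r; lra.
Qed.

Lemma cheb_sin t k : cheb (cos t) k * sin t = sin (k%:R * t).
Proof.
suff [] : cheb (cos t) k * sin t = sin (k%:R * t) /\
          cheb (cos t) k.+1 * sin t = sin (k.+1%:R * t) by [].
elim: k => [|k [IH1 IH2]]; first by rewrite /= !mul0r sin0 !mul1r.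
split=> //; rewrite chebSS mulrBl IH1 -(mulrA _ (cheb _ k.+1)) IH2.
have -> : k.+2%:R * t = k.+1%:R * t + t by rewrite -[k.+2%:R]natr1 mulrDl mul1r.
have -> : k%:R * t = k.+1%:R * t - t by rewrite -[k.+1%:R]natr1 mulrDl mul1r addrK.
by rewrite sinB sinD; ring.
Qed.

Section Angle.
Context (m : nat) (m2 : (2 <= m)%N).
Let t : R := pi / m%:R.

Let m_gt0 : 0 < m%:R :> R. Proof. by rewrite ltr0n; lia. Qed.

Let sin_t_gt0 : 0 < sin t.
Proof.
apply: sin_gt0_pi; rewrite divr_gt0 ?pi_gt0 //= ltr_pdivrMr //.
by rewrite ltr_pMr ?pi_gt0 // ltr1n.
Qed.

Lemma cheb_cos_ge0 k : (k <= m)%N -> 0 <= cheb (cos t) k.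
Proof.
move=> km; rewrite -(pmulr_lge0 _ sin_t_gt0) cheb_sin; apply: sin_ge0_pi.
have t0 : 0 <= t by rewrite divr_ge0 ?pi_ge0.
rewrite mulr_ge0 //= mulrCA ger_pMr ?pi_gt0 // ler_pdivrMr // mul1r.
by rewrite ler_nat.
Qed.

Lemma cheb_cos_eq0 : cheb (cos t) m = 0.
Proof.
apply: (mulIf (lt0r_neq0 sin_t_gt0)); rewrite cheb_sin mul0r.
by rewrite mulrCA mulfV ?lt0r_neq0 // mulr1 sinpi.
Qed.

Lemma cheb_cos_eq1 : cheb (cos t) m.-1 = 1.
Proof.
apply: (mulIf (lt0r_neq0 sin_t_gt0)); rewrite cheb_sin mul1r.
have -> : m.-1%:R * t = pi - t.
  have -> : m.-1%:R = m%:R - 1 :> R by rewrite -subn1 natrB //; lia.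
  by rewrite mulrBl mul1r mulrCA mulfV ?lt0r_neq0 // mulr1.
by rewrite sinB sinpi cospi; ring.
Qed.

End Angle.
End Chebyshev.

Section Positivity.
Context {R : realType} {V : lmodType R} {B : {symmetric V}} {Pi : set V}.
Context (hPi : simple_system B Pi).
Implicit Types (u v a b : V) (x y z w p : GL V).
Local Notation cone := (nonneg_span Pi).
Local Notation S := (simple_reflections B Pi).
Local Notation W := (weyl B Pi).
Local Notation l := (len B Pi).
Local Notation s := (refl B).

Lemma weyl_isometry w u v : W w -> B (w u) (w v) = B u v.
Proof.
move=> /weyl_has_word -/(_ hPi)[n [r [_ rS ->]]] {w n}.
elim: r rS u v => [|t r IH] rS u v; first by rewrite big_nil.
rewrite big_cons !GLME; have [a aPi <-] := rS t (mem_head _ _).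
rewrite refl_isometry ?(simple_form1 hPi) // IH // => g gr.
by apply: rS; rewrite in_cons gr orbT.
Qed.

(** Letters are added on the left, so that the word ends in [s b] for all [k > 0]. *)
Fixpoint alt a b k : GL V :=
  if k is k'.+1 then (s (if odd k' then a else b) * alt a b k')%g else 1%g.

Lemma alt_word a b k : Pi a -> Pi b -> has_word S (alt a b k) k.
Proof.
move=> aPi bPi; elim: k => [|k IH] /=; first exact: has_word1.
by rewrite -add1n; apply: has_wordM IH; apply: has_word_refl; case: odd.
Qed.

Lemma weyl_of_word w n : has_word S w n -> W w.
Proof.
move=> [r [_ + ->]] {w n}; elim: r => [|t r IH] rS.
  by rewrite big_nil; apply: weyl1.
rewrite big_cons; have [a aPi <-] := rS t (mem_head _ _).
apply: weylM (weyl_simple aPi) (IH _) => g gr.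
by apply: rS; rewrite in_cons gr orbT.
Qed.

Lemma alt_root a b k : Pi a -> Pi b ->
  alt a b k a = cheb (- B a b) k.+1 *: (if odd k then b else a)
              + cheb (- B a b) k *: (if odd k then a else b).
Proof.
move=> aPi bPi; have [aa bb] := (simple_form1 hPi aPi, simple_form1 hPi bPi).
elim: k => [|k IH]; first by rewrite /= scale1r scale0r addr0.
rewrite [alt _ _ _]/= GLME IH GLD !GLZ chebSS [odd k.+1]/=.
by case: (odd k) => /=; rewrite refl_self // reflE // ?(bformC b) scalerBr scalerA
  scalerN -addrA -opprD -scalerDl -scaleNr [RHS]addrC; congr (_ + _ *: _); ring.
Qed.

(** The word of length [m - 1] maps [a] to the root of the letter that comes next
    on its left; conjugation by the word therefore turns this letter into [s a]. *)
Lemma alt_braid a b m : Pi a -> Pi b -> (2 <= m)%N -> B a b = - cos (pi / m%:R) ->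
  (alt a b m * s a = alt a b m.-1)%g.
Proof.
case: m => // m aPi bPi m2 abE.
rewrite -[m.+1.-1]/m [alt _ _ _]/=.
have -> : (if odd m then a else b) = alt a b m a.
  rewrite alt_root // abE opprK cheb_cos_eq0 // scale0r add0r.
  by rewrite (cheb_cos_eq1 m2) scale1r.
have aa := simple_form1 hPi aPi; rewrite refl_conj //; last first.
  by move=> u v; apply: weyl_isometry; apply: weyl_of_word (alt_word m aPi bPi).
by rewrite mulgVK -mulgA reflM // mulg1.
Qed.

(** By induction on the length.  Choose a simple reflection [s b] that shortens [w];
    it is different from [s a].  Now split off from the right of [w] the
    longest possible reduced alternating word in [s a] and [s b].  By maximality
    the rest [p] is not shortened by either reflection, so by induction [p a] and
    [p b] are positive, and the alternating word sends [a] to a non-negative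
    combination of [a] and [b]: its coefficients can only become negative when
    the word is long enough to be rewritten so that it ends in [s a]. *)
Lemma cone_of_len_le w a : W w -> Pi a -> (l w <= l (w * s a)%g)%N -> cone (w a).
Proof.
have [n] := ubnP (l w); elim: n w a => // n IH w a; rewrite ltnS => wn wW aPi wa.
have [->|w1] := pselect (w = 1%g); first by rewrite GL1E; apply: cone_simple.
have [b bPi wb] := right_descent hPi wW w1.
have ab : a <> b by move=> E; move: wa; rewrite E wb ltnn.
pose P k := `[< exists p, [/\ W p, w = (p * alt a b k)%g & l w = (l p + k)%N] >].
have P1 : P 1%N.
  apply/asboolP; exists (w * s b)%g; split; last by rewrite addn1.
    exact: weylM (weyl_simple bPi).
  by rewrite /= mulg1 (mulgsK hPi bPi).
have exP : exists k, P k by exists 1%N.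
have Pw k : P k -> (k <= l w)%N.
  by move=> /asboolP[p [_ _ ->]]; rewrite leq_addl.
case: (ex_maxnP exP Pw) => k /asboolP[p [pW wE wl]] kmax.
have k1 := kmax _ P1.
pose c := if odd k then a else b; have cPi : Pi c by rewrite /c; case: odd.
pose d := if odd k.-1 then a else b; have dPi : Pi d by rewrite /d; case: odd.
have altW j : W (alt a b j) by apply: weyl_of_word (alt_word j aPi bPi).
have altl j : (l (alt a b j) <= j)%N by exact: len_min (alt_word j aPi bPi).
have pc : (l p <= l (p * s c)%g)%N.
  rewrite leqNgt; apply/negP => lt; have pcW := weylM pW (weyl_simple (B := B) cPi).
  have wE' : w = (p * s c * alt a b k.+1)%g.
    by rewrite /= -/c -!mulgA (mulsgK hPi cPi).
  have := lenM hPi pcW (altW k.+1); rewrite -wE' => le.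
  have := altl k.+1 => ak; suff : P k.+1 by move/kmax; rewrite ltnn.
  by apply/asboolP; exists (p * s c)%g; split=> //; lia.
have pd : (l p <= l (p * s d)%g)%N.
  rewrite leqNgt; apply/negP => lt; have pdW := weylM pW (weyl_simple (B := B) dPi).
  have wE' : w = (p * s d * alt a b k.-1)%g.
    by rewrite wE -(prednK k1) /= -/d -!mulgA.
  have := lenM hPi pdW (altW k.-1); rewrite -wE' => le.
  by have := altl k.-1; lia.
have pn : (l p < n)%N by lia.
have dE : d = if odd k then b else a.
  by rewrite /d -{2}(prednK k1) /=; case: odd.
have [cone_c cone_d] : cone (p c) /\ cone (p d) by split; apply: IH.
have wcone : 0 <= cheb (- B a b) k.+1 -> 0 <= cheb (- B a b) k -> cone (w a).
  move=> k0 k0'; rewrite wE GLME alt_root // GLD !GLZ.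
  rewrite -/c -dE; apply: coneD; exact: coneZ.
case: (hPi) => _ _ /(_ a b aPi bPi ab) [[m m2 abE]|le]; last first.
  have c1 : 1 <= - B a b by rewrite lerNr.
  have /andP[k0 kk] := cheb_incr k c1.
  exact: wcone (le_trans k0 kk) k0.
have [km|mk] := ltnP k m.
  by apply: wcone; rewrite abE opprK; apply: cheb_cos_ge0 => //; exact: ltnW.
exfalso.
have short j : has_word S (alt a b (j + m) * s a)%g (j + m.-1).
  elim: j => [|j IHj] /=.
    by rewrite !add0n alt_braid //; apply: alt_word.
  rewrite -mulgA -add1n -addnA; apply: has_wordM IHj.
  by apply: has_word_refl; case: odd.
have := short (k - m)%N; rewrite subnK // => {}short.
have := lenM hPi pW (weylM (altW k) (weyl_simple (B := B) aPi)).
rewrite mulgA -wE => le1.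
have := len_min hPi (weyl_of_word short) short.
by move=> le2; have := leq_trans wa (leq_trans le1 (leq_add (leqnn _) le2)); lia.
Qed.

End Positivity.

(** * Roots, inversion sets and the weak order *)

Section Roots.
Context {R : realType} {V : lmodType R} {B : {symmetric V}} {Pi : set V}.
Context (hPi : simple_system B Pi).
Implicit Types (u v a b : V) (x y z w : GL V).
Local Notation cone := (nonneg_span Pi).
Local Notation W := (weyl B Pi).
Local Notation l := (len B Pi).
Local Notation s := (refl B).
Local Notation root := (root_system B Pi).
Local Notation pos := (pos_roots B Pi).
Local Notation N := (inv_set B Pi).

Lemma root_simple a : Pi a -> root a.
Proof. by move=> aPi; exists 1%g; [exact: weyl1|exists a]. Qed.

Lemma root_act w v : W w -> root v -> root (w v).
Proof. by move=> wW [x xW [a aPi ->]]; exists (w * x)%g; [exact: weylM|exists a]. Qed.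

Lemma root_form1 v : root v -> B v v = 1.
Proof.
move=> [w wW [a aPi ->]]; rewrite (weyl_isometry hPi) //.
exact: simple_form1 hPi _ aPi.
Qed.

Lemma root_neq0 v : root v -> v <> 0.
Proof. by move=> /root_form1 vv v0; move: vv; rewrite v0 linear0l => /eqP; rewrite eq_sym oner_eq0. Qed.

Lemma weyl_refl_act w a : W w -> root a -> (s (w a) = w * s a * w^-1)%g.
Proof.
move=> wW ra; apply: refl_conj; first exact: root_form1.
by move=> u v; apply: (weyl_isometry hPi).
Qed.

Lemma weyl_refl v : root v -> W (s v).
Proof.
move=> [w wW [a aPi ->]]; rewrite weyl_refl_act //; last exact: root_simple.
by apply: weylMV => //; apply: weylM => //; apply: weyl_simple.
Qed.

Lemma root_refl u v : root v -> root u -> root (s v u).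
Proof. by move=> rv; apply: root_act; apply: weyl_refl. Qed.

Lemma root_opp v : root v -> root (- v).
Proof. by move=> rv; rewrite -(refl_self (root_form1 rv)); apply: root_refl. Qed.

Lemma root_reflE u v : root v -> s v u = u - (2 * B u v) *: v.
Proof. by move=> rv; rewrite reflE //; apply: root_form1. Qed.

Lemma root_reflK v : root v -> involutive (s v).
Proof. by move=> /root_form1/reflK. Qed.

Lemma root_reflM v : root v -> (s v * s v = 1)%g.
Proof. by move=> /root_form1/reflM. Qed.

Lemma invg_mulr w v : root v -> ((w * s v)^-1 = s v * w^-1)%g.
Proof. by move=> /root_form1 vv; rewrite invgM reflV. Qed.

Lemma invg_mull w v : root v -> ((s v * w)^-1 = w^-1 * s v)%g.
Proof. by move=> /root_form1 vv; rewrite invgM reflV. Qed.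

Lemma mulgrK v : root v -> involutive (fun x => x * s v)%g.
Proof. by move=> rv x; rewrite -mulgA root_reflM ?mulg1. Qed.

Lemma mulrgK v : root v -> involutive (fun x => s v * x)%g.
Proof. by move=> rv x; rewrite mulgA root_reflM ?mul1g. Qed.

Lemma pos_root v : pos v -> root v.
Proof. by case. Qed.

Lemma pos_simple a : Pi a -> pos a.
Proof. by move=> aPi; split; [exact: root_simple|exact: cone_simple]. Qed.

Lemma pos_or_neg v : root v -> pos v \/ pos (- v).
Proof.
move=> rv; have rNv := root_opp rv; case: (rv) => w wW [a aPi vE].
have [le|lt] := leqP (l w) (l (w * s a)%g).
  by left; split=> //; rewrite vE; apply: (cone_of_len_le hPi).
right; split=> //; have aa := simple_form1 hPi aPi.
rewrite vE -GLN -(refl_self aa) -GLME.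
apply: (cone_of_len_le hPi) => //; first exact: weylM wW (weyl_simple aPi).
by rewrite (mulgsK hPi aPi) ltnW.
Qed.

Lemma posN v : pos v -> ~ pos (- v).
Proof. by move=> [rv vc] [_ nvc]; apply: (root_neq0 rv); apply: (cone_pointed hPi). Qed.

Lemma NposP v : root v -> ~ pos v <-> pos (- v).
Proof.
move=> rv; split; first by case: (pos_or_neg rv).
by move=> nv vp; apply: posN vp nv.
Qed.

Lemma pos_comb u v p q : pos u -> pos v -> 0 <= p -> 0 <= q ->
  root (p *: u + q *: v) -> pos (p *: u + q *: v).
Proof. by move=> [_ uc] [_ vc] p0 q0 r; split=> //; apply: coneD; apply: coneZ. Qed.

Lemma root_ray u v c : root u -> root v -> 0 <= c -> v = c *: u -> v = u.
Proof.
move=> ru rv c0 vE; have := root_form1 rv.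
rewrite vE !bformE (root_form1 ru) mulr1 => cc.
suff -> : c = 1 by rewrite scale1r.
have /eqP : (c - 1) * (c + 1) = 0 by move: cc; lra.
by rewrite mulf_eq0 => /orP[/eqP|/eqP]; lra.
Qed.

(** A simple reflection only changes the coefficient of its own simple root, so a
    positive root with another simple root in its support stays positive. *)
Lemma pos_simple_refl a v : Pi a -> pos v -> v <> a -> pos (s a v).
Proof.
move=> aPi vp va; have [rv vc] := vp; have ra := root_simple aPi.
case: (pos_or_neg (root_refl ra rv)) => // -[_ nc]; exfalso; apply: va.
have [|c c0] := cone_face hPi (t := 2 * B v a) aPi vc nc; last exact: root_ray.
by rewrite root_reflE // opprB addrC addrNK.
Qed.

Lemma len_mulr_pos w a : W w -> Pi a -> pos (w a) -> l (w * s a)%g = (l w).+1.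
Proof.
move=> wW aPi wa; have saW := weyl_simple (B := B) aPi; have ra := root_simple aPi.
apply/eqP; rewrite eqn_leq len_mulsr //= ltnNge; apply/negP => le.
apply: (posN wa); split; first exact/root_opp/pos_root.
rewrite -GLN -(refl_self (root_form1 ra)) -GLME.
by apply: (cone_of_len_le hPi) => //; [exact: weylM|rewrite mulgrK].
Qed.

Lemma len_mulr_neg w a : W w -> Pi a -> pos (- w a) -> l w = (l (w * s a)%g).+1.
Proof.
move=> wW aPi wa; have ra := root_simple aPi; rewrite -{1}[w](mulgrK ra).
apply: len_mulr_pos => //; first exact: weylM wW (weyl_refl ra).
by rewrite GLME refl_self ?GLN //; apply: root_form1.
Qed.

Lemma len_mull_pos w a : W w -> Pi a -> pos ((w^-1)%g a) -> l (s a * w)%g = (l w).+1.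
Proof.
move=> wW aPi wa; have ra := root_simple aPi; have wVW := weylV wW.
rewrite -(lenV hPi wW) -(lenV hPi (weylM (weyl_refl ra) wW)) invg_mull //.
exact: len_mulr_pos.
Qed.

Lemma len_mull_neg w a : W w -> Pi a -> pos (- (w^-1)%g a) -> l w = (l (s a * w)%g).+1.
Proof.
move=> wW aPi wa; have ra := root_simple aPi; have wVW := weylV wW.
rewrite -(lenV hPi wW) -(lenV hPi (weylM (weyl_refl ra) wW)) invg_mull //.
exact: len_mulr_neg.
Qed.

Lemma invP z b : N z b <-> pos b /\ pos (- (z^-1)%g b).
Proof.
split=> [[bp [_ [c cp <-] zc]]|[bp cp]].
  by split=> //; rewrite -zc glVK opprK.
split=> //; exists ((z^-1)%g b); last exact: glKV.
by exists (- (z^-1)%g b); rewrite ?opprK.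
Qed.

Lemma inv_pos z b : N z b -> pos b.
Proof. by case. Qed.

Lemma inv_root z b : N z b -> root b.
Proof. by move=> /inv_pos/pos_root. Qed.

Lemma NinvP z b : W z -> pos b -> ~ N z b <-> pos ((z^-1)%g b).
Proof.
move=> zW bp; have rb := root_act (weylV zW) (pos_root bp); split.
  by case: (pos_or_neg rb) => // nb []; apply/invP.
by move=> zb /invP[_]; apply: posN.
Qed.

Lemma coinvP z b : W z -> coinv_set B Pi z b <-> pos b /\ pos ((z^-1)%g b).
Proof.
by move=> zW; split=> [[bp zb]|[bp zb]]; split=> //; apply/(NinvP zW bp).
Qed.

Lemma inv1 b : ~ N 1%g b.
Proof. by move=> /invP[bp]; rewrite invg1; apply: posN. Qed.

Lemma inv_mulr w a : W w -> Pi a -> pos (w a) ->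
  forall b, N (w * s a)%g b <-> N w b \/ b = w a.
Proof.
move=> wW aPi wa b; have ra := root_simple aPi; rewrite !invP invg_mulr // GLME.
set c := (w^-1)%g b; have bE : b = w c by rewrite glKV.
split=> [[bp nc]|[[bp nc]|ba]].
- have rc : root c by apply: root_act (weylV wW) (pos_root bp).
  have [E|ca] := pselect (c = a); first by right; rewrite bE E.
  left; split=> //; apply/(NposP rc) => cp.
  exact: posN (pos_simple_refl aPi cp ca) nc.
- split=> //; rewrite -GLN; apply: pos_simple_refl => // ca.
  by apply: (posN wa); rewrite -ca GLN -bE opprK.
- rewrite ba; split=> //; rewrite /c ba glVK refl_self ?opprK; first exact: pos_simple.
  exact: root_form1.
Qed.

Lemma inv_mull w a : W w -> Pi a -> pos ((w^-1)%g a) ->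
  forall b, N (s a * w)%g b <-> b = a \/ N w (s a b).
Proof.
move=> wW aPi wa b; have ra := root_simple aPi; rewrite !invP invg_mull // GLME.
have aa := root_form1 ra; split=> [[bp nb]|[->|[bp nb]]].
- by have [|ba] := pselect (b = a); [left|right; split=> //; apply: pos_simple_refl].
- by rewrite refl_self // GLN opprK; split=> //; apply: pos_simple.
- split=> //; rewrite -(root_reflK ra b); apply: pos_simple_refl => // E.
  by move: nb; rewrite E; apply: posN.
Qed.

Lemma inv_simple w a : W w -> Pi a -> N w a <-> pos (- (w^-1)%g a).
Proof. by move=> wW aPi; rewrite invP; split=> [[]|] //; split=> //; apply: pos_simple. Qed.

Lemma descent_notin w a : W w -> Pi a -> N w a -> ~ N (s a * w)%g a.
Proof.
move=> wW aPi /invP[ap na] /invP[_]; rewrite invg_mull; last exact: root_simple.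
rewrite GLME refl_self ?GLN ?opprK; last exact/root_form1/root_simple.
by move/(@posN _); apply.
Qed.

Lemma descent_pos w a : W w -> Pi a -> N w a -> pos ((s a * w)^-1 a)%g.
Proof.
move=> wW aPi aN; apply/NinvP; last exact: descent_notin.
  exact: weylM (weyl_simple aPi) wW.
exact: pos_simple.
Qed.

Lemma len_descent w a : W w -> Pi a -> N w a -> l w = (l (s a * w)%g).+1.
Proof. by move=> wW aPi /invP[_]; apply: len_mull_neg. Qed.

Lemma inv_descent w a : W w -> Pi a -> N w a ->
  forall b, N w b <-> b = a \/ N (s a * w)%g (s a b).
Proof.
move=> wW aPi aN b; have ra := root_simple aPi.
rewrite -{1}[w](mulrgK ra); apply: inv_mull => //; last exact: descent_pos.
exact: weylM (weyl_refl ra) wW.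
Qed.

Lemma inv_descent_mono x y a : W x -> W y -> Pi a -> N x a -> N x `<=` N y ->
  N (s a * x)%g `<=` N (s a * y)%g.
Proof.
move=> xW yW aPi ax xy b bx; have ra := root_simple aPi.
have : N x (s a b) by apply/(inv_descent xW aPi ax); right; rewrite root_reflK.
move/xy/(inv_descent yW aPi (xy _ ax)); rewrite root_reflK //; case=> // ba.
exfalso; apply: (posN (inv_pos bx)); rewrite -(root_reflK ra b) ba.
by rewrite refl_self ?opprK; [exact: pos_simple|exact: root_form1].
Qed.

Lemma exists_descent w : W w -> w <> 1%g -> exists2 a, Pi a & N w a.
Proof.
move=> wW w1; have [a aPi la] := left_descent hPi wW w1.
exists a => //; apply/inv_simple => //; apply/NposP.
  exact: root_act (weylV wW) (root_simple aPi).
by move/(len_mull_pos wW aPi); lia.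
Qed.

Lemma inv_mul_mono x (u : GL V) : W x -> W u -> l (x * u)%g = (l x + l u)%N ->
  N x `<=` N (x * u)%g.
Proof.
have [n] := ubnP (l u); elim: n u => // n IH u; rewrite ltnS => un xW uW lxu.
have [->|u1] := pselect (u = 1%g); first by rewrite mulg1.
have [a aPi la] := right_descent hPi uW u1; have ra := root_simple aPi.
have uaW : W (u * s a)%g := weylM uW (weyl_refl ra).
have xuaW := weylM xW uaW; have := lenM hPi xW uaW => le.
have := len_mulsr hPi xuaW aPi; rewrite -!mulgA root_reflM // mulg1 lxu => ge.
have lxua : l (x * (u * s a))%g = (l x + l (u * s a)%g)%N by lia.
have uan : (l (u * s a)%g < n)%N by lia.
move=> b /(IH _ uan xW uaW lxua) bN.
have xuE : (x * u = x * (u * s a) * s a)%g by rewrite -!mulgA root_reflM // mulg1.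
rewrite xuE; apply/inv_mulr => //; last by left.
have : root ((x * (u * s a))%g a) := root_act xuaW ra.
case/pos_or_neg => // /(len_mulr_neg xuaW aPi); rewrite -xuE; lia.
Qed.

Lemma weak_leP x y : W x -> W y -> weak_le B Pi x y <-> N x `<=` N y.
Proof.
move=> xW yW; split=> [le|].
  rewrite -[y](mulVKg x); apply: inv_mul_mono => //; first exact: weylM (weylV xW) yW.
  by rewrite mulVKg.
rewrite /weak_le; have [n] := ubnP (l x); elim: n x y xW yW => // n IH x y xW yW.
rewrite ltnS => xn xy.
have [->|x1] := pselect (x = 1%g); first by rewrite len1 // invg1 mul1g.
have [a aPi ax] := exists_descent xW x1; have ay := xy _ ax.
have aW := weyl_simple (B := B) aPi; have ra := root_simple aPi.
have lx := len_descent xW aPi ax; have ly := len_descent yW aPi ay.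
have E : ((s a * x)^-1 * (s a * y) = x^-1 * y)%g.
  by rewrite invg_mull // -mulgA mulrgK.
rewrite ly lx addSn -E; congr _.+1; apply: IH; [exact: weylM|exact: weylM|lia|].
exact: inv_descent_mono.
Qed.

Lemma inv_set_inj x y : W x -> W y -> N x = N y -> x = y.
Proof.
move=> xW yW E; have /(weak_leP xW yW) le : N x `<=` N y by rewrite E.
have /(weak_leP yW xW) ge : N y `<=` N x by rewrite E.
have E1 : l (x^-1 * y)%g = 0%N by move: le ge; rewrite /weak_le; lia.
by rewrite -[y](mulVKg x) (len_eq0 hPi (weylM (weylV xW) yW) E1) mulg1.
Qed.

Lemma len_inv_mono x y : W x -> W y -> N x `<=` N y -> (l x <= l y)%N.
Proof. by move=> xW yW /(weak_leP xW yW) ->; apply: leq_addr. Qed.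

(** On the way from [x] up to [y] one inversion is created at each step; [r] is the
    element reached just after [b] has been created. *)
Lemma inv_crossing x y b : W x -> W y -> N x `<=` N y -> N y b -> ~ N x b ->
  exists r a, [/\ W r, Pi a, N x `<=` N r, N r `<=` N y & r a = - b].
Proof.
have [n] := ubnP (l y - l x); elim: n x => // n IH x; rewrite ltnS.
move=> xn xW yW xy yb xb; have /(weak_leP xW yW) := xy; rewrite /weak_le.
have [u [uW yE]] : exists u : GL V, W u /\ y = (x * u)%g.
  by exists (x^-1 * y)%g; rewrite mulVKg; split=> //; exact: weylM (weylV xW) yW.
rewrite {1 2}yE mulKg => lxy.
have [u1|u1] := pselect (u = 1%g); first by case: xb; rewrite -[x]mulg1 -u1 -yE.
have [a aPi la] := left_descent hPi uW u1; have ra := root_simple aPi.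
have xaW := weylM xW (weyl_refl ra); have auW := weylM (weyl_refl ra) uW.
have yE' : y = (x * s a * (s a * u))%g by rewrite -mulgA mulrgK.
have le := lenM hPi xaW auW; rewrite -yE' yE in le.
have xa : pos (x a).
  have : root (x a) := root_act xW ra.
  by case/pos_or_neg => // /(len_mulr_neg xW aPi) lx; exfalso; lia.
have lxa := len_mulr_pos xW aPi xa.
have xay : N (x * s a)%g `<=` N y.
  by apply/weak_leP => //; rewrite /weak_le yE' mulKg -yE' yE; lia.
have xxa : N x `<=` N (x * s a)%g by move=> c cx; apply/(inv_mulr xW aPi xa); left.
have [bE|bE] := pselect (b = x a).
  exists (x * s a)%g, a; split=> //.
  by rewrite GLME refl_self ?GLN ?bE //; apply: root_form1.
have [||r [c [rW cPi xr ry rc]]] := IH (x * s a)%g _ xaW yW xay yb.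
- have ly : l y = (l x + l u)%N by rewrite yE.
  by lia.
- by move/(inv_mulr xW aPi xa) => [].
by exists r, c; split=> // d /xxa/xr.
Qed.

Lemma len_refl_neg w v : W w -> pos v -> pos (- (w^-1)%g v) -> (l (s v * w)%g < l w)%N.
Proof.
have [n] := ubnP (l w); elim: n w v => // n IH w v; rewrite ltnS => wn wW vp nv.
have [w1|w1] := pselect (w = 1%g).
  by exfalso; apply: (posN vp); move: nv; rewrite w1 invg1.
have [a aPi aN] := exists_descent wW w1; have lw := len_descent wW aPi aN.
have [->|va] := pselect (v = a); first by rewrite lw.
have ra := root_simple aPi; have aW := weyl_refl ra; have rv := pos_root vp.
have awW := weylM aW wW; have E : (s v * w = s a * (s (s a v) * (s a * w)))%g.
  by rewrite (weyl_refl_act aW rv) !mulgA root_reflM // mul1g mulgVK.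
have lt : (l (s (s a v) * (s a * w))%g < l (s a * w)%g)%N.
  apply: IH => //; [lia|exact: pos_simple_refl|].
  by rewrite invg_mull // GLME root_reflK.
have sW := weylM (weyl_refl (root_refl ra rv)) awW.
by rewrite E; have := lenM hPi aW sW; have := len_simple hPi aPi; lia.
Qed.

Lemma len_refl_pos w v : W w -> pos v -> pos ((w^-1)%g v) -> (l w < l (s v * w)%g)%N.
Proof.
move=> wW vp wv; have rv := pos_root vp; rewrite -{1}[w](mulrgK rv).
apply: len_refl_neg => //; first exact: weylM (weyl_refl rv) wW.
by rewrite invg_mull // GLME refl_self ?GLN ?opprK //; apply: root_form1.
Qed.

End Roots.

(** * Closed sets of roots and bounded joins *)

Section Joins.
Context {R : realType} {V : lmodType R} {B : {symmetric V}} {Pi : set V}.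
Context (hPi : simple_system B Pi).
Implicit Types (u v a b : V) (x y z w : GL V) (G H : set V).
Local Notation W := (weyl B Pi).
Local Notation l := (len B Pi).
Local Notation s := (refl B).
Local Notation root := (root_system B Pi).
Local Notation pos := (pos_roots B Pi).
Local Notation N := (inv_set B Pi).
Local Notation closed := (closed_roots B Pi).
Local Notation clo := (root_closure B Pi).

Lemma clo_min G H : closed H -> G `<=` H -> clo G `<=` H.
Proof. exact: smallest_sub. Qed.

Lemma clo_sub G : G `<=` clo G.
Proof. exact: sub_smallest. Qed.

Lemma clo_comb G u v p q : clo G u -> clo G v -> 0 <= p -> 0 <= q ->
  root (p *: u + q *: v) -> clo G (p *: u + q *: v).
Proof.
move=> Gu Gv p0 q0 r H HG; have [[_ Hcl] GH] := HG.
by apply: Hcl => //; [apply: Gu|apply: Gv].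
Qed.

Lemma clo_root G : G `<=` root -> clo G `<=` root.
Proof. by apply: clo_min; split. Qed.

Lemma clo_closed G : G `<=` root -> closed (clo G).
Proof. by move=> Gr; split; [exact: clo_root|move=> *; exact: clo_comb]. Qed.

Lemma clo_absorb G H : G `<=` clo H -> H `<=` root -> clo G `<=` clo H.
Proof. by move=> GH Hr; apply: clo_min => //; apply: clo_closed. Qed.

Lemma clo_act w G H : W w -> G `<=` root ->
  (forall b, G b -> clo H (w b)) -> forall b, clo G b -> clo H (w b).
Proof.
move=> wW Gr GH b Gb.
suff : [set c | root c /\ clo H (w c)] b by case.
move: Gb; apply: clo_min; last by move=> c Gc; split; [exact: Gr|exact: GH].
split=> [c []//|c d p q [rc Hc] [rd Hd] p0 q0 r]; split=> //.
rewrite GLD !GLZ; apply: clo_comb => //; rewrite -!GLZ -GLD.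
exact: root_act.
Qed.

Lemma inv_comb z u v p q : W z -> N z u -> N z v -> 0 <= p -> 0 <= q ->
  root (p *: u + q *: v) -> N z (p *: u + q *: v).
Proof.
move=> zW /invP[up nu] /invP[vp nv] p0 q0 r; apply/invP; split.
  exact: pos_comb.
have := root_opp hPi (root_act (weylV zW) r).
rewrite GLD !GLZ opprD -!scalerN; exact: pos_comb.
Qed.

Lemma coinv_comb z u v p q : W z -> coinv_set B Pi z u -> coinv_set B Pi z v ->
  0 <= p -> 0 <= q -> root (p *: u + q *: v) ->
  coinv_set B Pi z (p *: u + q *: v).
Proof.
move=> zW /(coinvP hPi _ zW)[up zu] /(coinvP hPi _ zW)[vp zv] p0 q0 r.
apply/(coinvP hPi _ zW); split; first exact: pos_comb.
by have := root_act (weylV zW) r; rewrite GLD !GLZ; apply: pos_comb.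
Qed.

Lemma inv_closed z : W z -> closed (N z).
Proof. by move=> zW; split=> [b /inv_root//|*]; apply: inv_comb. Qed.

Lemma coinv_closed z : W z -> closed (coinv_set B Pi z).
Proof. by move=> zW; split=> [b [/pos_root//]|*]; apply: coinv_comb. Qed.

Lemma inv_sub_root z : N z `<=` root.
Proof. by move=> b /inv_root. Qed.

Lemma root_setU G H : G `<=` root -> H `<=` root -> G `|` H `<=` root.
Proof. by move=> Gr Hr b [/Gr|/Hr]. Qed.

Lemma inv_quotient (u : GL V) z : W u -> W z -> N u `<=` N z ->
  forall b, N z b <-> N u b \/ N (u^-1 * z)%g ((u^-1)%g b).
Proof.
move=> uW zW uz b; rewrite !invP invgM invgK GLME glKV; split.
  move=> [bp nb]; have rb := root_act (weylV uW) (pos_root bp).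
  by case: (pos_or_neg hPi rb) => ub; [right|left].
move=> [/invP/uz/invP//|[ub nb]]; split=> //.
have rb : root b by rewrite -(glKV u b); exact: root_act uW (pos_root ub).
case: (pos_or_neg hPi rb) => // nbp; exfalso.
have /uz/invP[_] : N u (- b) by apply/invP; rewrite GLN opprK.
by rewrite GLN opprK => bp; apply: (posN hPi bp nb).
Qed.

Lemma inv_quotient_act (u : GL V) z b : W u -> W z -> N u `<=` N z ->
  N (u^-1 * z)%g b <-> pos b /\ N z (u b).
Proof.
move=> uW zW uz; rewrite (inv_quotient uW zW uz) glVK; split.
  by move=> bN; split; [exact: inv_pos bN|right].
by move=> [bp [/invP[_]|//]]; rewrite glVK => /(posN hPi bp).
Qed.

(** Inductions on the length strip a common left descent [a]; this is the way
    back. *)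
Lemma clo_lift a y G H : Pi a -> W y -> H `<=` root -> N y = clo H -> ~ N y a ->
  (forall b, G b <-> b = a \/ H (s a b)) -> N (s a * y)%g = clo G.
Proof.
move=> aPi yW Hr yE ya GH; have ra : root a := root_simple aPi; have saW := weyl_refl hPi ra.
have ay : pos ((y^-1)%g a) by apply/(NinvP hPi yW (pos_simple aPi)).
have yP := inv_mull hPi yW aPi ay.
apply/seteqP; split=> b.
  move=> /yP[->|]; first by apply: clo_sub; apply/GH; left.
  rewrite yE => Hb; rewrite -(root_reflK hPi ra b).
  apply: clo_act Hb => // c Hc; apply: clo_sub; apply/GH; right.
  by rewrite (root_reflK hPi ra).
apply: clo_min; first exact: inv_closed (weylM saW yW).
by move=> c /GH[->|Hc]; apply/yP; [left|right; rewrite yE; apply: clo_sub].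
Qed.

Section Dihedral.
Context (a b : V) (aPi : Pi a) (bPi : Pi b) (ab : a <> b).

Lemma pos_span p q : pos (p *: a + q *: b) -> 0 <= p /\ 0 <= q.
Proof.
have half c d (cPi : Pi c) (dPi : Pi d) (cd : c <> d) p' q' :
    pos (p' *: c + q' *: d) -> 0 <= p'.
  move=> [_ cone]; rewrite leNgt; apply/negP => p0.
  have [||e e0 eE] := cone_face hPi (u := (- p') *: c) (t := q') dPi _ cone.
  - by apply: coneZ; [rewrite oppr_ge0 ltW|exact: cone_simple].
  - by rewrite scaleNr addKr.
  have : B ((- p') *: c) c = B (e *: d) c by rewrite eE.
  rewrite !bformZl (simple_form1 hPi cPi) mulr1 => E.
  have : e * B d c <= 0 by rewrite mulr_ge0_le0 // (simple_form_le0 hPi dPi cPi) //; apply: nesym.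
  by rewrite -E oppr_le0 leNgt p0.
move=> pp; split; first exact: half pp.
by move: pp; rewrite addrC; apply: half => //; apply: nesym.
Qed.

Lemma clo_pair c : clo [set a; b] c ->
  exists p q, [/\ 0 <= p, 0 <= q & c = p *: a + q *: b].
Proof.
suff sub : clo [set a; b] `<=`
    [set c | root c /\ exists p q, [/\ 0 <= p, 0 <= q & c = p *: a + q *: b]].
  by move=> /sub[].
apply: clo_min; last first.
  move=> _ [->|->]; split; try exact: root_simple.
    by exists 1, 0; rewrite scale1r scale0r addr0 ler01 lexx.
  by exists 0, 1; rewrite scale1r scale0r add0r ler01 lexx.
split=> [d []//|d e t r [_ [p [q [p0 q0 ->]]]] [_ [p' [q' [p'0 q'0 ->]]]] t0 r0 rr].
split=> //; exists (t * p + r * p'), (t * q + r * q').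
split; try by rewrite addr_ge0 ?mulr_ge0.
by rewrite !scalerDr !scalerA !scalerDl addrACA.
Qed.

Let span c := exists p q, c = p *: a + q *: b.

Let span_refl c d : c \in [:: a; b] -> span d -> span (s c d).
Proof.
move=> cab [p [q ->]]; have cPi : Pi c.
  by move: cab; rewrite !inE => /orP[/eqP->|/eqP->].
rewrite (root_reflE hPi _ (root_simple cPi)).
set t := 2 * _; move: cab; rewrite !inE => /orP[/eqP->|/eqP->].
  by exists (p - t), q; rewrite scalerBl addrAC.
by exists p, (q - t); rewrite scalerBl addrA.
Qed.

(** If [a] and [b] are both inversions of some [v], then so are all positive
    roots in their plane, so the elements of the group generated by [s a] and
    [s b] have bounded length.  A longest one makes all these roots negative. *)
Lemma dihedral_longest (v : GL V) : W v -> N v a -> N v b ->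
  exists u : GL V, W u /\ N u = clo [set a; b].
Proof.
move=> vW va vb; have [ra rb] := (root_simple (B := B) aPi, root_simple (B := B) bPi).
have clov : clo [set a; b] `<=` N v.
  by apply: clo_min; [exact: inv_closed|move=> _ [->|->]].
pose D (u : GL V) := [/\ W u, (forall c, span c -> span (u c)),
  forall c, span c -> span ((u^-1)%g c) & N u `<=` clo [set a; b]].
pose P k := `[< exists2 u, D u & l u = k >].
have P0 : exists k, P k.
  exists 0%N; apply/asboolP; exists 1%g; last exact: len1.
  split=> [|//|c|c /inv1-/(_ hPi)//]; first exact: weyl1.
  by rewrite invg1.
have Pv k : P k -> (k <= l v)%N.
  move=> /asboolP[u [uW _ _ uN] <-]; apply: (len_inv_mono hPi) => //.
  exact: subset_trans clov.
case: (ex_maxnP P0 Pv) => k /asboolP[u [uW uspan uVspan uN] <-] umax.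
have neg c : c \in [:: a; b] -> pos (- u c).
  move=> cab; have cPi : Pi c by move: cab; rewrite !inE => /orP[/eqP->|/eqP->].
  have rc := root_simple (B := B) cPi.
  case: (pos_or_neg hPi (root_act uW rc)) => // ucp; exfalso.
  suff : P (l (u * s c)%g) by move/umax; rewrite (len_mulr_pos hPi) // ltnn.
  apply/asboolP; exists (u * s c)%g => //; split.
  - exact: weylM uW (weyl_refl hPi rc).
  - by move=> d /(span_refl cab) /uspan.
  - by move=> d /uVspan /(span_refl cab); rewrite (invg_mulr hPi _ rc).
  move=> d /(inv_mulr hPi uW cPi ucp)[/uN//|->].
  have [p [q E]] : span (u c).
    apply: uspan; move: cab; rewrite !inE => /orP[/eqP->|/eqP->].
      by exists 1, 0; rewrite scale1r scale0r addr0.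
    by exists 0, 1; rewrite scale1r scale0r add0r.
  move: ucp; rewrite E => ucp; have [p0 q0] := pos_span ucp.
  by apply: clo_comb (pos_root ucp) => //; apply: clo_sub; [left|right].
exists u; split=> //; apply/seteqP; split=> // c; apply: clo_min.
  exact: inv_closed.
move=> d dab; have dPi : Pi d by case: dab => ->.
apply/invP; split; first exact: pos_simple.
have rd := root_act (weylV uW) (root_simple dPi).
case: (pos_or_neg hPi rd) => // dp; exfalso.
have [p [q E]] : span ((u^-1)%g d).
  apply: uVspan; case: dab => ->; first by exists 1, 0; rewrite scale1r scale0r addr0.
  by exists 0, 1; rewrite scale1r scale0r add0r.
move: (dp); rewrite E => /pos_span[p0 q0].
have dE : - d = p *: - u a + q *: - u b.
  by rewrite !scalerN -opprD -!GLZ -GLD -E glKV.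
apply: (posN hPi (pos_simple (B := B) dPi)); rewrite dE.
apply: pos_comb => //; try by apply: neg; rewrite !inE eqxx ?orbT.
by rewrite -dE; apply: (root_opp hPi); apply: root_simple.
Qed.

End Dihedral.

Lemma inv_join_descent x z a b : W x -> W z -> Pi a -> N x a -> N z a ->
  (N x `|` N z) b <-> b = a \/ (N (s a * x)%g `|` N (s a * z)%g) (s a b).
Proof.
move=> xW zW aPi xa za; rewrite /setU /= (inv_descent hPi xW aPi xa).
rewrite (inv_descent hPi zW aPi za); tauto.
Qed.

(** By induction on the bound, since a common left descent can be stripped from
    all elements.  Otherwise, take left descents [a] of [x] and [b]
    of [z]; the bound is above the longest element [u] of the group generated by
    [s a] and [s b].  Now [x] and [u] have the common descent [a], and their join
    and [z] have the common descent [b]. *)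
Lemma bounded_join (v : GL V) x z : W v -> W x -> W z -> N x `<=` N v -> N z `<=` N v ->
  exists y : GL V, W y /\ N y = clo (N x `|` N z).
Proof.
have [n] := ubnP (l v); elim: n v x z => // n IH v x z; rewrite ltnS => vn vW.
have common x' z' a : W x' -> W z' -> N x' `<=` N v -> N z' `<=` N v ->
    Pi a -> N x' a -> N z' a -> exists y : GL V, W y /\ N y = clo (N x' `|` N z').
  move=> xW zW xv zv aPi xa za; have saW := weyl_simple (B := B) aPi.
  have va := xv _ xa; have lv := len_descent hPi vW aPi va.
  have [||||||y [yW yE]] := IH (s a * v)%g (s a * x')%g (s a * z')%g.
  - by lia.
  - exact: weylM.
  - exact: weylM.
  - exact: weylM.
  - exact: inv_descent_mono.
  - exact: inv_descent_mono.
  have yv : N y `<=` N (s a * v)%g.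
    rewrite yE; apply: clo_min; first exact: inv_closed (weylM saW vW).
    by move=> b []; apply: inv_descent_mono.
  exists (s a * y)%g; split; first exact: weylM.
  apply: (clo_lift aPi yW _ yE).
  - by apply: root_setU; exact: inv_sub_root.
  - by move/yv; apply: (descent_notin hPi vW aPi va).
  - by move=> b; apply: inv_join_descent.
move=> xW zW xv zv.
have clo_inv y : W y -> clo (N y) = N y.
  move=> yW; apply/seteqP; split; last exact: clo_sub.
  by apply: clo_min => //; apply: inv_closed.
have N1 : N 1%g = set0 by apply/seteqP; split=> b // /(inv1 hPi).
have [x1|x1] := pselect (x = 1%g).
  by exists z; rewrite x1 N1 set0U clo_inv.
have [z1|z1] := pselect (z = 1%g).
  by exists x; rewrite z1 N1 setU0 clo_inv.
have [a aPi xa] := exists_descent hPi xW x1.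
have [b bPi zb] := exists_descent hPi zW z1.
have [za|za] := pselect (N z a); first exact: (common _ _ a).
have ab : a <> b by move=> E; apply: za; rewrite E.
have [u [uW uE]] := dihedral_longest aPi bPi ab vW (xv _ xa) (zv _ zb).
have uv : N u `<=` N v.
  rewrite uE; apply: clo_min; first exact: inv_closed.
  by move=> _ [->|->]; [exact: xv|exact: zv].
have [|p [pW pE]] := common x u a xW uW xv uv aPi xa.
  by rewrite uE; apply: clo_sub; left.
have xur : N x `|` N u `<=` root by apply: root_setU; exact: inv_sub_root.
have xzr : N x `|` N z `<=` root by apply: root_setU; exact: inv_sub_root.
have pv : N p `<=` N v.
  by rewrite pE; apply: clo_min; [exact: inv_closed|move=> c []; [exact: xv|exact: uv]].
have [|y [yW yE]] := common z p b zW pW zv pv bPi zb.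
  by rewrite pE; apply: clo_sub; right; rewrite uE; apply: clo_sub; right.
exists y; split=> //; rewrite yE; apply/seteqP; split; apply: clo_absorb => //.
- move=> c [zc|]; first by apply: clo_sub; right.
  rewrite pE; apply: clo_absorb => // d [xd|]; first by apply: clo_sub; left.
  rewrite uE; apply: clo_absorb => // _ [->|->]; apply: clo_sub; [by left|by right].
- move=> c [xc|zc]; apply: clo_sub; last by left.
  by right; rewrite pE; apply: clo_sub; left.
- by apply: root_setU; exact: inv_sub_root.
Qed.

End Joins.

(** * Covers in Bruhat order and joins *)

Section Covers.
Context {R : realType} {V : lmodType R} {B : {symmetric V}} {Pi : set V}.
Context (hPi : simple_system B Pi).
Implicit Types (a b d n : V) (x y z w : GL V) (G H : set V).
Local Notation W := (weyl B Pi).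
Local Notation l := (len B Pi).
Local Notation s := (refl B).
Local Notation root := (root_system B Pi).
Local Notation pos := (pos_roots B Pi).
Local Notation N := (inv_set B Pi).
Local Notation clo := (root_closure B Pi).

Definition bruhat_cover x a : Prop :=
  [/\ W x, pos a & l (s a * x)%g = (l x).+1].

Lemma cover_weyl x a : bruhat_cover x a -> W (s a * x)%g.
Proof. by move=> [xW /pos_root/(weyl_refl hPi) aW _]; apply: weylM. Qed.

Lemma cover_pos x a : bruhat_cover x a -> pos ((x^-1)%g a).
Proof.
move=> [xW ap lx]; have := root_act (weylV xW) (pos_root ap).
by case/(pos_or_neg hPi) => // /(len_refl_neg hPi xW ap); rewrite lx; lia.
Qed.

Lemma cover_notin x a : bruhat_cover x a -> ~ N x a.
Proof. by move=> c; have [xW ap _] := c; apply/(NinvP hPi xW ap)/cover_pos. Qed.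

Lemma cover_in x a : bruhat_cover x a -> N (s a * x)%g a.
Proof.
move=> c; have [_ ap _] := c; have ra := pos_root ap; apply/invP; split=> //.
rewrite (invg_mull hPi _ ra) GLME (refl_self (root_form1 hPi ra)) GLN opprK.
exact: cover_pos.
Qed.

Lemma cover_simple x a : W x -> Pi a -> ~ N x a -> bruhat_cover x a.
Proof.
move=> xW aPi xa; have ap := pos_simple (B := B) aPi; split=> //.
by apply: (len_mull_pos hPi) => //; apply/(NinvP hPi xW ap).
Qed.

Lemma refl_strip x a d : root a -> Pi d ->
  (s (s d a) * (s d * x) = s d * (s a * x))%g.
Proof.
move=> ra dPi; rewrite (weyl_refl_act hPi (weyl_simple dPi) ra).
by rewrite !mulgA mulgVK.
Qed.

(** Any left descent [d] of [s a * x] will do.  If it were not one of [x], then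
    [s d * x] would be as long as [s a * x], hence longer than [s d * s a * x],
    although the latter arises from [s d * x] by the reflection in the positive
    root [s d a], which lengthens it. *)
Lemma cover_common_descent x a : bruhat_cover x a -> ~ Pi a ->
  exists d, [/\ Pi d, N x d & N (s a * x)%g d].
Proof.
move=> c aPi; have [xW ap lx] := c; have wW := cover_weyl c; have ra := pos_root ap.
have w1 : (s a * x)%g <> 1%g by move=> E; move: lx; rewrite E len1.
have [d dPi wd] := exists_descent hPi wW w1; exists d; split=> //.
apply: contrapT => xd; have rd : root d := root_simple dPi.
have dW := weyl_refl hPi rd; have dp := pos_simple (B := B) dPi.
have [_ _ ldx] := cover_simple xW dPi xd.
have lw := len_descent hPi wW dPi wd.
have ad : pos (s d a) by apply: pos_simple_refl => // E; apply: aPi; rewrite E.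
have := len_refl_pos hPi (weylM dW xW) ad.
rewrite (invg_mull hPi _ rd) GLME (root_reflK hPi rd) => /(_ (cover_pos c)).
by rewrite (refl_strip _ ra dPi); lia.
Qed.

Lemma cover_strip x a d : bruhat_cover x a -> Pi d -> N x d -> N (s a * x)%g d ->
  bruhat_cover (s d * x)%g (s d a).
Proof.
move=> c dPi xd wd; have [xW ap lx] := c; have wW := cover_weyl c.
have dW : W (s d) := weyl_simple dPi; split; first exact: weylM.
  by apply: pos_simple_refl => // E; apply: (cover_notin c); rewrite E.
rewrite (refl_strip _ (pos_root ap) dPi).
have := len_descent hPi xW dPi xd; have := len_descent hPi wW dPi wd; lia.
Qed.

(** In each plane through [a], the longer element of a cover has just one more
    inversion than the shorter one, so [s a] cannot swap two of its inversions up
    to sign.  This is seen by stripping common descents until [a] is simple. *)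
Lemma cover_swap x a n : bruhat_cover x a -> N (s a * x)%g n -> n <> a ->
  ~ N (s a * x)%g (- s a n).
Proof.
have [k] := ubnP (l x); elim: k x a n => // k IH x a n; rewrite ltnS => xk c wn na wn'.
have [xW ap lx] := c; have wW := cover_weyl c; have ra := pos_root ap.
have [aPi|aPi] := pselect (Pi a).
  by apply: (posN hPi (pos_simple_refl hPi aPi (inv_pos wn) na)); exact: inv_pos wn'.
have [d [dPi xd wd]] := cover_common_descent c aPi.
have rd : root d := root_simple dPi; have dW := weyl_refl hPi rd.
have not_d m : N (s a * x)%g (- s a m) -> m <> d.
  move=> /invP[_] + md; rewrite md (invg_mull hPi _ ra) GLME !GLN opprK.
  by rewrite (root_reflK hPi ra) => /(posN hPi); apply; case/invP: xd.
have nd := not_d _ wn'.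
have n'd : - s a n <> d by apply: not_d; rewrite GLN (root_reflK hPi ra) opprK.
have [//|wn1] := (inv_descent hPi wW dPi wd n).1 wn.
have [//|wn2] := (inv_descent hPi wW dPi wd (- s a n)).1 wn'.
have lt : (l (s d * x)%g < k)%N by have := len_descent hPi xW dPi xd; lia.
have := IH _ _ (s d n) lt (cover_strip c dPi xd wd).
rewrite (refl_strip _ ra dPi) => /(_ wn1); apply.
  by move/(congr1 (s d)); rewrite !(root_reflK hPi rd).
rewrite (weyl_refl_act hPi dW ra) !GLME glVK.
by move: wn2; rewrite GLN.
Qed.

(** An inversion [n] of [s a * x] that is neither [a] nor an inversion of [x] is a
    non-negative combination of [a] and the inversion [s a n] of [x]. *)
Lemma cover_inv_sub x a : bruhat_cover x a -> N (s a * x)%g `<=` clo (N x `|` [set a]).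
Proof.
move=> c n wn; have [xW ap lx] := c; have wW := cover_weyl c; have ra := pos_root ap.
have [->|na] := pselect (n = a); first by apply: clo_sub; right.
have [np nn] := (invP _ _).1 wn; have rn := pos_root np.
have sub b : N x b -> clo (N x `|` [set a]) b by move=> xb; apply: clo_sub; left.
have wV b : ((s a * x)^-1)%g b = (x^-1)%g (s a b) by rewrite (invg_mull hPi _ ra).
case: (pos_or_neg hPi (root_refl hPi ra rn)) => sn; last first.
  apply: sub; apply/invP; split=> //.
  have : ~ N (s a * x)%g (- s a n) by apply: cover_swap.
  by move/(NinvP hPi wW sn); rewrite wV !GLN (root_reflK hPi ra).
have xsn : N x (s a n) by apply/invP; rewrite -wV.
have nE : n = 1 *: s a n + (2 * B n a) *: a.
  by rewrite scale1r (root_reflE hPi _ ra) subrK.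
have [t0|t0] := leP 0 (2 * B n a).
  rewrite nE; apply: clo_comb; rewrite -?nE //; first exact: sub.
  by apply: clo_sub; right.
apply: sub; apply/invP; split=> //; have [_ xn] := (invP _ _).1 xsn.
have E : - (x^-1)%g n = 1 *: - (x^-1)%g (s a n) + (- (2 * B n a)) *: (x^-1)%g a.
  by rewrite {1}nE GLD !GLZ opprD scalerN scaleNr.
rewrite E; apply: pos_comb => //.
- exact: cover_pos.
- by rewrite oppr_ge0 ltW.
by rewrite -E; apply: (root_opp hPi); exact: root_act (weylV xW) rn.
Qed.

Lemma inv_set1_root x a : root a -> N x `|` [set a] `<=` root.
Proof. by move=> ra b [/inv_root|->]. Qed.

Lemma cover_join x a (v : GL V) : bruhat_cover x a -> W v -> N x `<=` N v -> N v a ->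
  exists y : GL V, [/\ W y, N y = clo (N x `|` [set a]) & N (s a * x)%g `<=` N y].
Proof.
move=> c vW xv va; have [xW ap lx] := c; have wW := cover_weyl c.
have sub := cover_inv_sub c; have rxa := inv_set1_root (x := x) (pos_root ap).
have wv : N (s a * x)%g `<=` N v.
  apply: subset_trans sub _; apply: clo_min; first exact: inv_closed.
  by move=> b [/xv|->].
have [y [yW yE]] := bounded_join hPi vW xW wW xv wv.
exists y; split=> //; last by rewrite yE => b wb; apply: clo_sub; right.
rewrite yE; apply/seteqP; split; apply: clo_absorb => //.
- by move=> b [xb|/sub//]; apply: clo_sub; left.
- move=> b [xb|->]; apply: clo_sub; [by left|right; exact: cover_in].
- by apply: root_setU; exact: inv_sub_root.
Qed.

Lemma refl_eq_mulr y a t : W y -> Pi t -> root a -> y t = - a ->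
  (s a * y = y * s t)%g.
Proof.
move=> yW tPi ra yt; have rt : root t := root_simple tPi.
rewrite -(reflN (root_form1 hPi ra)) -yt (weyl_refl_act hPi yW rt).
by rewrite mulgVK.
Qed.

Lemma inv_remove_last y a t : W y -> Pi t -> pos a -> y t = - a ->
  forall b, N (s a * y)%g b <-> N y b /\ b <> a.
Proof.
move=> yW tPi ap yt b; have rt : root t := root_simple tPi.
rewrite (refl_eq_mulr yW tPi (pos_root ap) yt).
have yst : (y * s t)%g t = a.
  by rewrite GLME (refl_self (root_form1 hPi rt)) GLN yt opprK.
have ytW := weylM yW (weyl_refl hPi rt).
have := inv_mulr hPi ytW tPi; rewrite yst => /(_ ap) P.
rewrite -{2}[y](mulgrK hPi rt) P; split=> [yb|[[//|//]]]; split; first by left.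
move=> ba; move: yb; rewrite ba => /invP[_].
by rewrite -yst glVK; exact: (posN hPi (pos_simple tPi)).
Qed.

(** Go up from [x] to [y].  The element reached just after [a] has been created
    already has all inversions that generate [N y], so it is [y]. *)
Lemma join_last x a y : W x -> W y -> pos a -> ~ N x a ->
  N y = clo (N x `|` [set a]) -> exists2 t, Pi t & y t = - a.
Proof.
move=> xW yW ap xa yE.
have xy : N x `<=` N y by rewrite yE => b xb; apply: clo_sub; left.
have ya : N y a by rewrite yE; apply: clo_sub; right.
have [r [t [rW tPi xr ry rt]]] := inv_crossing hPi xW yW xy ya xa.
have rra : N r a.
  apply/invP; split=> //; rewrite -(opprK a) -rt GLN opprK glVK.
  exact: pos_simple.
suff -> : y = r by exists t.
apply: (inv_set_inj hPi yW rW); apply/seteqP; split=> //; rewrite yE.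
by apply: clo_min; [exact: inv_closed|move=> b [/xr|->]].
Qed.

(** The positive root [s a c] has a non-negative coefficient at [a], which bounds the
    coefficient of [c] at [a] by that of a multiple of [s a b]. *)
Lemma clo_pair_remove a b c : Pi a -> Pi b -> a <> b ->
  clo [set a; b] c -> c <> a -> clo [set b; s a b] c.
Proof.
move=> aPi bPi ab cc ca; have ra : root a := root_simple aPi.
have rb : root b := root_simple bPi.
have rab : [set a; b] `<=` root by move=> _ [->|->].
have rc := clo_root rab cc.
have [p [q [p0 q0 cE]]] := clo_pair aPi bPi cc.
have cp : pos c.
  by rewrite cE; apply: pos_comb; rewrite -?cE //; exact: pos_simple.
set t := - (2 * B b a).
have sb : s a b = b + t *: a by rewrite (root_reflE hPi _ ra) scaleNr.
have : pos (s a c) by apply: pos_simple_refl.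
rewrite cE GLD !GLZ (refl_self (root_form1 hPi ra)) sb.
have -> : p *: - a + q *: (b + t *: a) = (q * t - p) *: a + q *: b.
  by rewrite scalerN scalerDr scalerA scalerBl addrC -addrA addrC.
move=> /(pos_span hPi aPi bPi ab)[qtp _].
have t0 : 0 <= t.
  by rewrite oppr_ge0 pmulr_rle0 // (simple_form_le0 hPi) //; apply: nesym.
have [t00|tn0] := eqVneq t 0.
  have p00 : p = 0 by move: qtp; rewrite t00 mulr0; lra.
  have E : p *: a + q *: b = q *: b + 0 *: b by rewrite p00 !scale0r addr0 add0r.
  by rewrite -cE cE E; apply: clo_comb; rewrite -?E -?cE //; apply: clo_sub; left.
have tp : 0 < t by rewrite lt_neqAle eq_sym tn0.
have E : c = (q - p / t) *: b + (p / t) *: s a b.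
  by rewrite cE sb scalerDr scalerA divfK // addrA -scalerDl subrK addrC.
rewrite -cE E; apply: clo_comb; rewrite -?E //.
- by apply: clo_sub; left.
- by apply: clo_sub; right.
- by rewrite subr_ge0 ler_pdivrMr // -subr_ge0.
- by rewrite divr_ge0.
Qed.

End Covers.

Arguments bruhat_cover {R V} B Pi x a.

Section JoinCover.
Context {R : realType} {V : lmodType R} {B : {symmetric V}} {Pi : set V}.
Context (hPi : simple_system B Pi).
Implicit Types (a b d n t : V) (x y z w : GL V) (G H : set V).
Local Notation W := (weyl B Pi).
Local Notation l := (len B Pi).
Local Notation s := (refl B).
Local Notation root := (root_system B Pi).
Local Notation pos := (pos_roots B Pi).
Local Notation N := (inv_set B Pi).
Local Notation clo := (root_closure B Pi).
Local Notation cover := (bruhat_cover B Pi).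

Definition cover_roots x a : set V := (N x `|` N (s a * x)%g) `\ a.

Lemma cover_roots_root x a : cover_roots x a `<=` root.
Proof. by move=> b [[/inv_root|/inv_root]]. Qed.

Lemma cover_rootsP x a b : cover x a -> N x b -> cover_roots x a b.
Proof. by move=> c xb; split; [left|move=> E; apply: (cover_notin hPi c); rewrite -E]. Qed.

Lemma cover_roots_refl x a b : cover x a -> Pi a ->
  clo (cover_roots x a) b -> clo (cover_roots x a) (s a b).
Proof.
move=> c aPi; have ra : root a := root_simple aPi; have [xW _ _] := c.
apply: clo_act b; [exact: weyl_simple|exact: cover_roots_root|].
have wP := inv_mull hPi xW aPi (cover_pos hPi c).
have nega b : pos b -> s a b <> a.
  move=> bp E; apply: (posN hPi bp); rewrite -(root_reflK hPi ra b) E.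
  by rewrite (refl_self (root_form1 hPi ra)) opprK; apply: pos_simple.
move=> b [[xb|wb] ba]; apply: clo_sub.
  split; last exact: nega (inv_pos xb).
  by right; apply/wP; right; rewrite (root_reflK hPi ra).
split; last exact: nega (inv_pos wb).
by left; case/wP: wb.
Qed.

(** Common left descents of [x] and [s a * x] can be stripped, so let [a] be
    simple; then the closure is stable under [s a].  For a left descent [b] of
    [x], the longest element of the group generated by [s a] and [s b] is
    [u1 * s t] with [u1 t = a].  The inversions of [u1] are in the closure, being
    generated by [b] and [s a b], so [x] may be replaced by its join with [u1].
    Removing the prefix [u1] leads to a shorter join, with [t] in place of [a]. *)
Lemma cover_join_remove x a y : cover x a -> W y ->
  N y = clo (N x `|` [set a]) ->
  forall b, N y b -> b <> a -> clo (cover_roots x a) b.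
Proof.
have [k] := ubnP (l y); elim: k x a y => // k IH x a y; rewrite ltnS.
move=> yk c yW yE; have [xW ap lx] := c; have ra := pos_root ap.
have xa := cover_notin hPi c.
have xy : N x `<=` N y by rewrite yE => b xb; apply: clo_sub; left.
have ya : N y a by rewrite yE; apply: clo_sub; right.
have [aPi|aPi] := pselect (Pi a); last first.
  have [d [dPi xd wd]] := cover_common_descent hPi c aPi.
  have rd : root d := root_simple dPi; have dW := weyl_refl hPi rd.
  have yd := xy _ xd; have dyW := weylM dW yW.
  have c' := cover_strip hPi c dPi xd wd.
  have xy' := inv_descent_mono hPi xW yW dPi xd xy.
  have ya' : N (s d * y)%g (s d a).
    by case/(inv_descent hPi yW dPi yd): ya => // E; case: aPi; rewrite E.
  have [y' [y'W y'E _]] := cover_join hPi c' dyW xy' ya'.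
  have y'y : N y' `<=` N (s d * y)%g.
    by rewrite y'E; apply: clo_min; [exact: inv_closed|move=> b [/xy'|->]].
  have y'd : ~ N y' d by move/y'y; apply: (descent_notin hPi yW dPi yd).
  have E : (s d * y')%g = y.
    apply: (inv_set_inj hPi (weylM dW y'W) yW); rewrite yE.
    apply: (clo_lift hPi dPi y'W _ y'E y'd).
      exact: inv_set1_root (root_refl hPi rd ra).
    move=> b; rewrite /setU /= (inv_descent hPi xW dPi xd b).
    split=> [[[->|xb]|->]|[->|[xb|/(congr1 (s d))]]].
    - by left.
    - by right; left.
    - by right; right.
    - by left; left.
    - by left; right.
    - by rewrite !(root_reflK hPi rd); right.
  move=> b; rewrite -E => /(inv_mull hPi y'W dPi) P ba.
  have y'dp : pos ((y'^-1)%g d) by apply/(NinvP hPi y'W (pos_simple dPi)).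
  case: (P y'dp) => [->|yb].
    by apply: clo_sub; apply: cover_rootsP.
  have lt : (l y' < k)%N.
    by have := len_descent hPi yW dPi yd; rewrite -{2}E (mulrgK hPi rd); lia.
  have ba' : s d b <> s d a by move/(congr1 (s d)); rewrite !(root_reflK hPi rd).
  have := IH _ _ _ lt c' y'W y'E _ yb ba'.
  move/(clo_act dW (H := cover_roots x a)); rewrite (root_reflK hPi rd); apply.
    exact: cover_roots_root.
  move=> g; rewrite /cover_roots (refl_strip hPi _ ra dPi) => -[gN ga].
  apply: clo_sub; split; last by move=> E'; apply: ga; rewrite /= -E' (root_reflK hPi rd).
  case: gN => gN; [left; apply/(inv_descent hPi xW dPi xd)|right].
    by right; rewrite (root_reflK hPi rd).
  apply/(inv_descent hPi (cover_weyl hPi c) dPi wd).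
  by right; rewrite (root_reflK hPi rd).
have aW := weyl_refl hPi ra; have wW := cover_weyl hPi c.
have [x1|x1] := pselect (x = 1%g).
  move=> b; have a1 : pos (((1 : GL V)^-1)%g a) by rewrite invg1.
  have aP := inv_mull hPi weyl1 aPi a1; rewrite yE x1 => ab ba; exfalso; apply: ba.
  have : N (s a * 1)%g b.
    move: ab; apply: clo_min; first exact: inv_closed (weylM aW weyl1).
    by move=> g [/(inv1 hPi)//|->]; apply/aP; left.
  by case/aP => // /(inv1 hPi).
have [b bPi xb] := exists_descent hPi xW x1; have rb : root b := root_simple bPi.
have ab : a <> b by move=> E; apply: xa; rewrite E.
have ba := nesym ab.
have [u [uW uE]] := dihedral_longest hPi aPi bPi ab yW ya (xy _ xb).
have bW := weyl_refl hPi rb.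
have NbE g : N (s b) g <-> g = b.
  have b1 : pos (((1 : GL V)^-1)%g b) by rewrite invg1; exact: pos_simple.
  have := inv_mull hPi weyl1 bPi b1 g; rewrite mulg1 => ->.
  by split=> [[|/(inv1 hPi)]//|]; left.
have uE' : N u = clo (N (s b) `|` [set a]).
  rewrite uE; congr (clo _); apply/seteqP; split=> g.
    by move=> [->|->]; [right|left; apply/NbE].
  by move=> [/NbE->|->]; [right|left].
have [|t tPi ut] := join_last hPi bW uW ap _ uE'; first by move/NbE.
have rt : root t := root_simple tPi.
have u1P := inv_remove_last hPi uW tPi ap ut.
have u1E := refl_eq_mulr hPi uW tPi ra ut.
set u1 := (s a * u)%g in u1P u1E; have u1W : W u1 := weylM aW uW.
have u1t : u1 t = a by rewrite /u1 GLME ut GLN (refl_self (root_form1 hPi ra)) opprK.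
have u1a : ~ N u1 a by case/u1P.
have u1b : N u1 b by apply/u1P; split=> //; rewrite uE; apply: clo_sub; right.
have stable := cover_roots_refl c aPi.
have croot := @cover_roots_root x a.
have xG g : N x g -> clo (cover_roots x a) g.
  by move=> xg; apply: clo_sub; apply: cover_rootsP.
have u1G : N u1 `<=` clo (cover_roots x a).
  move=> g /u1P[]; rewrite uE => gab ga.
  have := clo_pair_remove hPi aPi bPi ab gab ga; apply: clo_absorb => //.
  by move=> _ [->|->]; [exact: xG|apply: stable; exact: xG].
have [t' t'Pi yt'] := join_last hPi xW yW ap xa yE.
have yaP := inv_remove_last hPi yW t'Pi ap yt'.
have Gy : clo (cover_roots x a) `<=` N (s a * y)%g.
  apply: clo_min; first exact: inv_closed (weylM aW yW).
  move=> g [gN ga]; apply/yaP; split=> //; case: gN => [/xy//|].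
  by rewrite yE; apply: cover_inv_sub.
have u1y : N u1 `<=` N y by move=> g /u1G/Gy/yaP[].
have [x2 [x2W x2E]] := bounded_join hPi yW xW u1W xy u1y.
have x2G : N x2 `<=` clo (cover_roots x a).
  by rewrite x2E; apply: clo_absorb => // g [/xG|/u1G].
have u1x2 : N u1 `<=` N x2 by rewrite x2E => g ug; apply: clo_sub; right.
have xx2 : N x `<=` N x2 by rewrite x2E => g xg; apply: clo_sub; left.
have x2y : N x2 `<=` N y by move=> g /x2G/Gy/yaP[].
have x2a : ~ N x2 a by move=> /x2G/Gy/yaP[].
have u1VW := weylV u1W.
pose x3 := (u1^-1 * x2)%g; have x3W : W x3 := weylM u1VW x2W.
pose y3 := (u1^-1 * y)%g; have y3W : W y3 := weylM u1VW yW.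
have x3P g : N x3 g <-> pos g /\ N x2 (u1 g) by exact: inv_quotient_act.
have y3P g : N y3 g <-> pos g /\ N y (u1 g) by exact: inv_quotient_act.
have c3 : cover x3 t.
  by apply: (cover_simple hPi) => //; rewrite x3P u1t => -[].
have y3t : N y3 t by apply/y3P; rewrite u1t; split=> //; exact: pos_simple.
have x3y3 : N x3 `<=` N y3 by move=> g /x3P[gp /x2y ?]; apply/y3P.
have [z [zW zE zw]] := cover_join hPi c3 y3W x3y3 y3t.
have zy3 : N z `<=` N y3.
  by rewrite zE; apply: clo_min; [exact: inv_closed|move=> g [/x3y3|->]].
have u1zW := weylM u1W zW.
have u1z : N u1 `<=` N (u1 * z)%g.
  move=> g ug; have yg := u1y _ ug; apply/invP; split; first exact: inv_pos ug.
  rewrite invgM GLME; have [_ ng] := (invP _ _).1 ug.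
  have := (NinvP hPi zW ng).1; rewrite GLN; apply=> /zy3/y3P[_].
  by rewrite GLN glKV => /inv_pos; apply: (posN hPi (inv_pos ug)).
have zP g : N (u1 * z)%g g <-> N u1 g \/ N z ((u1^-1)%g g).
  by have := inv_quotient hPi u1W u1zW u1z g; rewrite mulKg.
have yz : N y `<=` N (u1 * z)%g.
  rewrite {1}yE; apply: clo_min; first exact: inv_closed.
  move=> g [xg|->]; apply/zP.
    case/(inv_quotient hPi u1W x2W u1x2): (xx2 _ xg) => [|x3g]; [by left|right].
    by rewrite zE; apply: clo_sub; left.
  by right; rewrite zE -u1t glVK; apply: clo_sub; right.
have y3E : N y3 = clo (N x3 `|` [set t]).
  rewrite -zE; apply/seteqP; split=> // g /y3P[gp /yz/zP[/invP[_]|]].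
    by rewrite glVK => /(posN hPi gp).
  by rewrite glVK.
have lt : (l y3 < k)%N.
  have /(weak_leP hPi u1W yW) := u1y; rewrite /weak_le -/y3 => ly.
  suff : (0 < l u1)%N by lia.
  rewrite lt0n; apply/eqP => /(len_eq0 hPi u1W) E.
  by move: u1b; rewrite E => /(inv1 hPi).
move=> g yg ga; case/(inv_quotient hPi u1W yW u1y): (yg) => [/u1G//|y3g].
have gt : (u1^-1)%g g <> t by move=> E; apply: ga; rewrite -u1t -E glKV.
have := IH _ _ _ lt c3 y3W y3E _ y3g gt.
move/(clo_act u1W (H := cover_roots x a)); rewrite glKV; apply.
  exact: cover_roots_root.
move=> h [[/x3P[_ /x2G]//|hN] ht].
case/(inv_mull hPi x3W tPi (cover_pos hPi c3)): hN => // /x3P[_ /x2G/stable].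
by rewrite -u1t (weyl_refl_act hPi u1W rt) !GLME glVK (root_reflK hPi rt).
Qed.

Lemma join_theorem x a (v : GL V) : cover x a -> W v ->
    N x `|` [set a] `<=` N v ->
  exists y : GL V,
    is_minimum B Pi [set z | [/\ W z, weak_le B Pi x z & N z a]] y
    /\ is_join B Pi x (s a * x)%g y
    /\ clo (N x `|` [set a]) = N y
    /\ N (s a * y)%g = N y `\ a
    /\ N y `\ a = clo (cover_roots x a)
    /\ weak_lt B Pi (s a * y)%g y
    /\ exists2 t, Pi t & (s a * y = y * s t)%g.
Proof.
move=> c vW xav; have [xW ap lx] := c; have ra := pos_root ap.
have aW := weyl_refl hPi ra; have wW := cover_weyl hPi c.
have xv : N x `<=` N v by move=> b xb; apply: xav; left.
have va : N v a by apply: xav; right.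
have [y [yW yE wy]] := cover_join hPi c vW xv va.
have xy : N x `<=` N y by rewrite yE => b xb; apply: clo_sub; left.
have ya : N y a by rewrite yE; apply: clo_sub; right.
have [t tPi yt] := join_last hPi xW yW ap (cover_notin hPi c) yE.
have ayP := inv_remove_last hPi yW tPi ap yt; have ayW := weylM aW yW.
have ayE : N (s a * y)%g = N y `\ a by apply/seteqP; split=> b /ayP.
have min z : W z -> N x `<=` N z -> N z a -> weak_le B Pi y z.
  move=> zW xz za; apply/(weak_leP hPi yW zW); rewrite yE; apply: clo_min.
    exact: inv_closed.
  by move=> b [/xz|->].
exists y; do !split=> //.
- exact/(weak_leP hPi).
- by move=> z [zW /(weak_leP hPi xW zW) xz za]; apply: min.
- exact/(weak_leP hPi).
- exact/(weak_leP hPi).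
- move=> z [zW /(weak_leP hPi xW zW) xz /(weak_leP hPi wW zW) wz].
  by apply: min => //; apply: wz; apply: cover_in.
- apply/seteqP; split=> [b [yb ba]|]; first exact: cover_join_remove yb ba.
  rewrite -ayE; apply: clo_min; first exact: inv_closed.
  by move=> b [bN ba]; apply/ayP; split=> //; case: bN => [/xy|/wy].
- by apply/(weak_leP hPi) => // b /ayP[].
- by move=> E; have /ayP[] : N (s a * y)%g a by rewrite E.
- by exists t => //; apply: (refl_eq_mulr hPi).
Qed.

End JoinCover.

(** * Roots that are positive at both ends of an interval *)

Section Walls.
Context {R : realType} {V : lmodType R} {B : {symmetric V}} {Pi : set V}.
Context (hPi : simple_system B Pi).
Implicit Types (a b k n t v : V) (p r x y z w : GL V) (G H : set V).
Local Notation cone := (nonneg_span Pi).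
Local Notation W := (weyl B Pi).
Local Notation l := (len B Pi).
Local Notation s := (refl B).
Local Notation root := (root_system B Pi).
Local Notation pos := (pos_roots B Pi).
Local Notation N := (inv_set B Pi).
Local Notation N' := (coinv_set B Pi).

Lemma exists_acute v : pos v -> exists2 k, Pi k & 0 < B v k.
Proof.
move=> [rv [q [c [qc vE]]]]; apply: contrapT => none.
have := root_form1 hPi rv; rewrite {2}vE linear_sumr big_seq /= => E.
have : \sum_(b <- q | b \in q) B v (c b *: b) <= 0.
  apply: sumr_le0 => b /qc[bPi cb]; rewrite bformZr mulr_ge0_le0 // leNgt.
  by apply/negP => vb; apply: none; exists b.
by rewrite E ler10.
Qed.

(** The length of the reflection in [v] measures the depth of [v]: it drops by two
    when a simple reflection is applied that makes an acute angle with [v]. *)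
Lemma len_refl_acute v k : pos v -> Pi k -> v <> k -> 0 < B v k ->
  l (s v) = (l (s (s k v))).+2.
Proof.
move=> vp kPi vk vk0; have [rv vc] := vp; have rk : root k := root_simple kPi.
have kv : s v k = k - (2 * B v k) *: v by rewrite (root_reflE hPi _ rv) bformC.
have t0 : 0 < 2 * B v k by rewrite mulr_gt0.
have vW := weyl_refl hPi rv; have kW := weyl_refl hPi rk.
have prop c : 0 <= c -> (2 * B v k) *: v = c *: k -> False.
  move=> c0 E; apply: vk; apply: (@root_ray _ _ _ _ hPi _ _ ((2 * B v k)^-1 * c)) => //.
    by rewrite mulr_ge0 // invr_ge0 ltW.
  by rewrite -scalerA -E scalerA mulVf ?lt0r_neq0 // scale1r.
have nk : pos (- s v k).
  case: (pos_or_neg hPi (root_refl hPi rv rk)) => // -[_ kc]; exfalso.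
  have [||c c0] := cone_face hPi (u := (2 * B v k) *: v) (t := 1) kPi _ kc.
  - exact: coneZ (ltW t0) vc.
  - by rewrite kv addrC subrK scale1r.
  exact: prop.
rewrite (len_mulr_neg hPi vW kPi nk); congr _.+1.
have vkW := weylM vW kW.
have -> : s (s k v) = (s k * (s v * s k))%g.
  rewrite (weyl_refl_act hPi kW rv) mulgA; congr (_ * _)%g.
  by rewrite (reflV (root_form1 hPi rk)).
apply: (len_mull_neg hPi vkW kPi).
rewrite (invg_mulr hPi _ rk) GLME (reflV (root_form1 hPi rv)) -GLN.
apply: pos_simple_refl => // E; apply: (@prop 2) => //.
by rewrite (scaler_nat 2) mulr2n -[X in _ = _ + X]E kv opprB addrC subrK.
Qed.

Lemma len_refl_obtuse v k : pos v -> Pi k -> v <> k -> B v k < 0 ->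
  l (s (s k v)) = (l (s v)).+2.
Proof.
move=> vp kPi vk vk0; have rk : root k := root_simple kPi.
rewrite -{2}(root_reflK hPi rk v); apply: len_refl_acute => //.
- exact: pos_simple_refl.
- move=> E; apply: (posN hPi vp); rewrite -(root_reflK hPi rk v) E.
  by rewrite (refl_self (root_form1 hPi rk)) opprK; apply: pos_simple.
rewrite -(refl_isometry _ _ (root_form1 hPi rk)) (root_reflK hPi rk).
by rewrite (refl_self (root_form1 hPi rk)) bformNr oppr_gt0.
Qed.

Lemma len_refl_acute_iff v k : pos v -> Pi k -> v <> k ->
  l (s v) = (l (s (s k v))).+2 -> 0 < B v k.
Proof.
move=> vp kPi vk E; have rk : root k := root_simple kPi.
case: (ltgtP (B v k) 0) => // [/(len_refl_obtuse vp kPi vk)|v0]; first by lia.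
by move: E; rewrite (root_reflE hPi _ rk) v0 mulr0 scale0r subr0; lia.
Qed.

(** Twice the usual depth minus one, of [v] as seen from the chamber of [z]. *)
Definition depth z v := l (s ((z^-1)%g v)).
Definition wdist x y := l (x^-1 * y)%g.

Lemma wdist_sub x y : W x -> W y -> N x `<=` N y -> l y = (l x + wdist x y)%N.
Proof. by move=> xW yW /(weak_leP hPi xW yW). Qed.

Lemma wdist_self x : wdist x x = 0%N.
Proof. by rewrite /wdist mulVg len1. Qed.

Lemma depth_le x y v : W x -> W y -> root v -> (depth y v <= depth x v + 2 * wdist x y)%N.
Proof.
move=> xW yW rv; have rxv := root_act (weylV xW) rv.
have gW := weylM (weylV yW) xW; have gVW := weylV gW.
rewrite /depth -{1}(glKV x v) -GLME (weyl_refl_act hPi gW rxv).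
have gE : l (y^-1 * x)%g = wdist x y.
  by rewrite /wdist -(lenV hPi gW) invgM invgK.
have sW := weyl_refl hPi rxv; have := lenM hPi (weylM gW sW) gVW.
have := lenM hPi gW sW; rewrite (lenV hPi gW) gE; set d := wdist x y.
move=> le1 le2; apply: leq_trans le2 _.
by apply: leq_trans (leq_add le1 (leqnn _)) _; lia.
Qed.

Lemma inv_lt x y b : W x -> W y -> N x `<=` N y -> N y b -> ~ N x b -> (l x < l y)%N.
Proof.
move=> xW yW xy yb xb; rewrite (wdist_sub xW yW xy) -{1}[l x]addn0 ltn_add2l lt0n.
apply/eqP => /(len_eq0 hPi (weylM (weylV xW) yW)) E; apply: xb.
by rewrite -[x]mulg1 -E mulVKg.
Qed.

Lemma inv_mulr_sub x y k : W x -> W y -> Pi k -> N x `<=` N y -> N y (x k) ->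
  [/\ N x `<=` N (x * s k)%g, N (x * s k)%g `<=` N y
    & wdist x y = (wdist (x * s k)%g y).+1].
Proof.
move=> xW yW kPi xy yk; have xk := inv_pos yk.
have kW := weyl_simple (B := B) kPi; have xkW := weylM xW kW.
have P := inv_mulr hPi xW kPi xk.
have xky : N (x * s k)%g `<=` N y by move=> b /P[/xy|->].
split=> //; first by move=> b xb; apply/P; left.
have := wdist_sub xW yW xy; have := wdist_sub xkW yW xky.
by rewrite (len_mulr_pos hPi xW kPi xk); lia.
Qed.

Lemma inv_mulr_sup p k : W p -> Pi k -> pos (- p k) ->
  [/\ N p (- p k), (forall b, N p b <-> N (p * s k)%g b \/ b = - p k)
    & l p = (l (p * s k)%g).+1].
Proof.
move=> pW kPi pk; have rk : root k := root_simple kPi.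
have pkW := weylM pW (weyl_refl hPi rk).
have E : (p * s k)%g k = - p k by rewrite GLME (refl_self (root_form1 hPi rk)) GLN.
have := inv_mulr hPi pkW kPi; rewrite E (mulgrK hPi rk) => /(_ pk) P.
by split=> //; [apply/P; right|exact: (len_mulr_neg hPi)].
Qed.

(** The positive roots outside [N y] are those that are positive on the whole
    interval below [y].  They all lie in a closed set [G] as soon as [G] contains
    the walls of this interval, that is, the roots [p k] with [p] below [y] and
    [k] simple; a second hypothesis excludes one configuration in which a root
    and a wall are related through an inversion of [y].

    The induction is on the depth of [rho] as seen from [y].  Choose [p] below [y]
    as far from [y] as possible among the elements from which the depth of [rho]
    is less by twice the distance to [y], and a simple root [k] with [p k] at an
    acute angle with [rho].  By the choice of [p], [p k] is a wall.  If the
    reflection [rho'] of [rho] in [p k] is positive at both ends, induction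
    applies to it.  If [rho'] is in [N y], then all inversions [n] of [y] in
    the plane of [rho] and [p k] make an obtuse angle with [rho], because the depth
    increases when they are created on the way from [p] to [y].  Reflecting
    [rho] in the last of them gives a root [sigma] of smaller depth, on the other side
    of [rho] from [p k] and positive at both ends. *)
Lemma walls_generate y G : W y -> closed_roots B Pi G ->
    (forall p k, W p -> N p `<=` N y -> Pi k -> N' y (p k) -> G (p k)) ->
    (forall p k rho, W p -> N p `<=` N y -> Pi k -> N' y (p k) ->
       N' y rho -> ~ G rho -> ~ N y (- s (p k) rho)) ->
  N' y `<=` G.
Proof.
move=> yW [Groot Gcomb] wall noswap rho.
have [m] := ubnP (depth y rho); elim: m rho => // m IH rho; rewrite ltnS => rm yrho.
have [rhop yVrho] := (coinvP hPi rho yW).1 yrho; have rrho := pos_root rhop.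
have [//|Grho] := pselect (G rho).
pose P j := `[< exists p, [/\ W p, N p `<=` N y, depth y rho = (depth p rho + 2 * j)%N
                            & wdist p y = j] >].
have P0 : exists j, P j.
  by exists 0%N; apply/asboolP; exists y; split=> //; [rewrite addn0|exact: wdist_self].
have Pb j : P j -> (j <= depth y rho)%N by move=> /asboolP[p [_ _ ->]]; lia.
(* [j] is the distance from [p] to [y]. *)
case: (ex_maxnP P0 Pb) => j /asboolP[p [pW py dpth pj]] jmax.
have above z : W z -> N z `<=` N y -> pos ((z^-1)%g rho).
  by move=> zW zy; apply/(NinvP hPi zW rhop) => /zy; case: yrho.
have prho := above p pW py.
have [k kPi ak] := exists_acute prho; have kW := weyl_simple (B := B) kPi.
have rk : root k := root_simple kPi.
have [pk|pk] := pselect ((p^-1)%g rho = k).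
  by case: Grho; rewrite -(glKV p rho) pk in yrho *; apply: wall.
have rkap := root_act pW rk; have pkW := weylM pW kW.
have pkd : depth p rho = (depth (p * s k)%g rho).+2.
  by rewrite /depth (invg_mulr hPi _ rk) GLME; apply: len_refl_acute.
(* If [p k] were negative, then [p * s k] would be a better choice than [p]. *)
have kapp : pos (p k).
  case: (pos_or_neg hPi rkap) => // npk; exfalso.
  have [_ PE lp] := inv_mulr_sup pW kPi npk.
  suff : P j.+1 by move/jmax; rewrite ltnn.
  have pky : N (p * s k)%g `<=` N y by move=> b pb; apply: py; apply/PE; left.
  apply/asboolP; exists (p * s k)%g; split=> //; first by lia.
  by have := wdist_sub pW yW py; have := wdist_sub pkW yW pky; lia.
(* If it were an inversion of [y], then the depth seen from [p * s k], which is
   closer to [y], would be too small. *)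
have ykap : N' y (p k).
  split=> // yk; have [_ _ E] := inv_mulr_sub pW yW kPi py yk.
  by have := depth_le pkW yW rrho; lia.
have Gkap := wall p k pW py kPi ykap.
have rhok : B rho (p k) = B ((p^-1)%g rho) k.
  by rewrite -[RHS](weyl_isometry hPi _ _ pW) glKV.
set kap := p k in rkap kapp ykap Gkap rhok.
pose c := 2 * B rho kap; have c0 : 0 < c by rewrite mulr_gt0 // rhok.
have rho'E : s kap rho = rho - c *: kap by rewrite (root_reflE hPi _ rkap).
have prho' : (p^-1)%g (s kap rho) = s k ((p^-1)%g rho).
  by rewrite (weyl_refl_act hPi pW rk) !GLME glVK.
have pposrho' : pos (s k ((p^-1)%g rho)) by apply: pos_simple_refl.
have rrho' := root_refl hPi rkap rrho.
case: (pos_or_neg hPi rrho') => rho'p; last first.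
  case: (noswap p k rho pW py kPi ykap yrho Grho); apply: py; apply/invP.
  by split=> //; rewrite GLN opprK prho'.
have [yrho'|yrho'] := pselect (N y (s kap rho)); last first.
  have lt : (depth y (s kap rho) < m)%N.
    apply: leq_trans rm; apply: leq_ltn_trans (depth_le pW yW rrho') _.
    have -> : depth p (s kap rho) = depth (p * s k)%g rho.
      by rewrite /depth prho' (invg_mulr hPi _ rk) GLME.
    by lia.
  have Grho' : G (s kap rho) by apply: IH.
  have E : rho = 1 *: s kap rho + c *: kap by rewrite rho'E scale1r subrK.
  by rewrite E; apply: Gcomb; rewrite -?E // ltW.
(* The elements reached just after creating an inversion [n] of [y] in the plane
   of [rho] and [p k]. *)
pose Q i := `[< exists r t, [/\ W r, Pi t, N p `<=` N r, N r `<=` N y & l r = i] /\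
   [/\ N y (- r t), ~ N p (- r t) & exists e f, - r t = e *: rho - f *: kap] >].
have nprho' : ~ N p (s kap rho) by apply/(NinvP hPi pW rho'p); rewrite prho'.
have Q0 : exists i, Q i.
  have [r [t [rW tPi pr ry rt]]] := inv_crossing hPi pW yW py yrho' nprho'.
  exists (l r); apply/asboolP; exists r, t; rewrite rt opprK; do !split=> //.
  by exists 1, c; rewrite scale1r.
have Qb i : Q i -> (i <= l y)%N.
  by move=> /asboolP[r [t [[rW _ _ ry <-] _]]]; apply: len_inv_mono.
case: (ex_maxnP Q0 Qb) => i /asboolP[r [t [[rW tPi pr ry <-] [yn pn [e [f nE]]]]]] imax.
have rt : root t := root_simple tPi.
set n := - r t in yn pn nE; have np := inv_pos yn.
(* As seen from [p], the wall is a simple root and [n] and [rho] are positive, and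
   only [n] is negative as seen from [y]. *)
have e0 : 0 < e.
  rewrite ltNge; apply/negP => e0.
  have pVn : pos ((p^-1)%g n) by apply/(NinvP hPi pW np).
  have pVE : (p^-1)%g n = e *: (p^-1)%g rho - f *: k by rewrite nE GLB !GLZ glVK.
  have [f0|f0] := leP 0 f.
    apply: (posN hPi pVn); rewrite pVE.
    have E : - (e *: (p^-1)%g rho - f *: k) = (- e) *: (p^-1)%g rho + f *: k.
      by rewrite opprB addrC scaleNr.
    have rn := root_opp hPi (pos_root pVn); rewrite pVE in rn.
    rewrite E; apply: pos_comb; rewrite -?E ?oppr_ge0 //; exact: pos_simple.
  have [||d d0 dE] := cone_face hPi (u := (p^-1)%g n) (v := (- e) *: (p^-1)%g rho)
    (t := - f) kPi (proj2 pVn) _ _.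
  - by apply: coneZ; [rewrite oppr_ge0|case: prho].
  - by rewrite pVE !scaleNr addrAC subrr add0r.
  have nk := root_ray hPi rk (pos_root pVn) d0 dE.
  by case: ykap => _; apply; rewrite /kap -nk glKV.
have f0 : 0 < f.
  rewrite ltNge; apply/negP => f0.
  have E : n = e *: rho + (- f) *: kap by rewrite nE scaleNr.
  have : N' y n.
    by rewrite E; apply: coinv_comb; rewrite -?E ?oppr_ge0 ?(ltW e0) //; exact: pos_root.
  by case.
have rrho_ := above r rW ry.
have nr : pos (- r t) by [].
have [rn rP lr] := inv_mulr_sup rW tPi nr.
have rtW := weylM rW (weyl_refl hPi rt).
have prt : N p `<=` N (r * s t)%g.
  by move=> b pb; case/rP: (pr _ pb) => // E; case: pn; rewrite /n -E.
have rty : N (r * s t)%g `<=` N y by move=> b rb; apply: ry; apply/rP; left.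
(* The depth grows at the maximal rate all the way from [p] to [y]. *)
have d_eq z : W z -> N p `<=` N z -> N z `<=` N y ->
    depth y rho = (depth z rho + 2 * wdist z y)%N.
  move=> zW pz zy; have := depth_le zW yW rrho; have := depth_le pW zW rrho.
  have := wdist_sub pW zW pz; have := wdist_sub zW yW zy.
  by have := wdist_sub pW yW py; lia.
have d1 := d_eq r rW pr ry; have d2 := d_eq _ rtW prt rty.
have w1 := wdist_sub rW yW ry; have w2 := wdist_sub rtW yW rty.
have d3 : depth r rho = (depth (r * s t)%g rho).+2 by lia.
have rtE : ((r * s t)^-1)%g rho = s t ((r^-1)%g rho).
  by rewrite (invg_mulr hPi _ rt) GLME.
have rhot : (r^-1)%g rho <> t.
  by move=> E; apply: (posN hPi rhop); rewrite -(glKV r rho) E.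
have acute : 0 < B ((r^-1)%g rho) t.
  by apply: len_refl_acute_iff => //; rewrite -rtE.
have rhon : B rho n = - B ((r^-1)%g rho) t.
  by rewrite -(weyl_isometry hPi ((r^-1)%g rho) t rW) glKV /n bformNr.
pose c' := - (2 * B rho n).
have c'0 : 0 < c' by rewrite /c' rhon mulrN opprK mulr_gt0.
have rootn := pos_root np.
have sigE : s n rho = rho + c' *: n by rewrite (root_reflE hPi _ rootn) -scaleNr.
have rsig := root_refl hPi rootn rrho.
have sigp : pos (s n rho).
  have E : s n rho = 1 *: rho + c' *: n by rewrite sigE scale1r.
  by rewrite E; apply: pos_comb; rewrite -?E // ltW.
have snE : s n = (r * s t * r^-1)%g.
  by rewrite /n reflN ?(root_form1 hPi (root_act rW rt)) // (weyl_refl_act hPi rW rt).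
have rsigE : (r^-1)%g (s n rho) = s t ((r^-1)%g rho) by rewrite snE !GLME glVK.
have rsigp : pos ((r^-1)%g (s n rho)) by rewrite rsigE; apply: pos_simple_refl.
have nrsig : ~ N r (s n rho) by apply/(NinvP hPi rW sigp).
have sigspan : s n rho = (1 + c' * e) *: rho - (c' * f) *: kap.
  by rewrite sigE nE scalerBr !scalerA scalerDl scale1r addrA.
(* Otherwise it would be an inversion created after [n] in the same plane. *)
have ysig : ~ N y (s n rho).
  move=> ysig; have [r2 [t2 [r2W t2Pi rr2 r2y E]]] := inv_crossing hPi rW yW ry ysig nrsig.
  have r2sig : N r2 (s n rho).
    apply/invP; split=> //; rewrite -[s n rho]opprK -E GLN glVK opprK.
    exact: pos_simple.
  have := inv_lt rW r2W rr2 r2sig nrsig; rewrite ltnNge => /negP; apply; apply: imax.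
  apply/asboolP; exists r2, t2; rewrite E opprK; split; split=> //.
  - exact: (subset_trans pr rr2).
  - by move/pr.
  - by exists (1 + c' * e), (c' * f).
have lt : (depth y (s n rho) < m)%N.
  apply: leq_trans rm; apply: leq_ltn_trans (depth_le rW yW rsig) _.
  have -> : depth r (s n rho) = depth (r * s t)%g rho by rewrite /depth rsigE rtE.
  by lia.
have Gsig : G (s n rho) by apply: IH.
case: Grho; set q := 1 + c' * e; have q0 : 0 < q by rewrite addr_gt0 // mulr_gt0.
have E : rho = q^-1 *: s n rho + (q^-1 * (c' * f)) *: kap.
  rewrite sigspan -/q scalerBr !scalerA mulVf ?lt0r_neq0 // scale1r.
  by rewrite subrK.
rewrite E; apply: Gcomb; rewrite -?E //; first by rewrite invr_ge0 ltW.
by rewrite !mulr_ge0 ?invr_ge0 ?ltW.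
Qed.

End Walls.

(** * Meets of covers *)

Section Meets.
Context {R : realType} {V : lmodType R} {B : {symmetric V}} {Pi : set V}.
Context (hPi : simple_system B Pi).
Implicit Types (b k n t : V) (p q z : GL V).
Local Notation W := (weyl B Pi).
Local Notation l := (len B Pi).
Local Notation s := (refl B).
Local Notation root := (root_system B Pi).
Local Notation pos := (pos_roots B Pi).
Local Notation N := (inv_set B Pi).
Local Notation N' := (coinv_set B Pi).
Local Notation clo := (root_closure B Pi).
Local Notation cover := (bruhat_cover B Pi).

(** A reflection that makes a positive root negative moves it across a positive
    multiple of its own root. *)
Lemma refl_neg_comb u v : pos u -> pos v -> pos (- s v u) ->
  exists2 c, 0 < c & v = c *: u + c *: - s v u.
Proof.
move=> up vp nvu; have rv := pos_root vp.
have E : u + - s v u = (2 * B u v) *: v.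
  by rewrite (root_reflE hPi _ rv) opprB addrC subrK.
have [t0|t0] := ltP 0 (2 * B u v).
  exists (2 * B u v)^-1; first by rewrite invr_gt0.
  by rewrite -scalerDr E scalerA mulVf ?lt0r_neq0 // scale1r.
exfalso; apply: (posN hPi up).
have F : - u = 1 *: - s v u + (- (2 * B u v)) *: v.
  by rewrite scaleNr -E scale1r opprD addrCA subrr addr0.
rewrite F; apply: pos_comb => //; first by rewrite oppr_ge0.
by rewrite -F; apply: (root_opp hPi); apply: pos_root.
Qed.

Section Meet.
Context (x : GL V) (a : V) (cov : cover (s a * x)%g a).
Let w := (s a * x)%g.

Let ap : pos a. Proof. by case: cov. Qed.
Let ra : root a. Proof. exact: pos_root ap. Qed.
Let aW : W (s a). Proof. exact: (weyl_refl hPi ra). Qed.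
Let wW : W w. Proof. by case: cov. Qed.
Let wx : (s a * w = x)%g. Proof. exact: (mulrgK hPi ra). Qed.
Let xW : W x. Proof. by rewrite -wx; apply: weylM. Qed.
Let xa : N x a. Proof. by rewrite -wx; apply: (cover_in hPi cov). Qed.
Let wa : ~ N w a. Proof. exact: (cover_notin hPi cov). Qed.
Let aa : s a a = - a. Proof. exact: (refl_self (root_form1 hPi ra)). Qed.
Let sK b : s a (s a b) = b. Proof. exact: (root_reflK hPi ra). Qed.

Let wV b : (w^-1)%g b = (x^-1)%g (s a b).
Proof. by rewrite /w (invg_mull hPi _ ra). Qed.

Let xV b : (x^-1)%g b = (w^-1)%g (s a b).
Proof. by rewrite wV sK. Qed.

Let swap n : N x n -> n <> a -> ~ N x (- s a n).
Proof. by have := cover_swap hPi cov; rewrite -/w wx; apply. Qed.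

(** An inversion [n] of [z] that is not one of [w] would be swapped by [s a], up to
    sign, with an inversion of [x], contrary to [cover_swap]. *)
Lemma below_cover z : W z -> N z `<=` N x -> ~ N z a -> N z `<=` N w.
Proof.
move=> zW zx za n zn; have xn := zx _ zn; have [np zVn] := (invP _ _).1 zn.
have rn := pos_root np; have zVa : pos ((z^-1)%g a) by apply/(NinvP hPi zW ap).
have na : n <> a by move=> E; apply: za; rewrite -E.
apply: contrapT => /(NinvP hPi wW np); rewrite wV => xsn.
have rsn := root_refl hPi ra rn.
case: (pos_or_neg hPi rsn) => sn; last first.
  by apply: (swap xn na); apply/invP; rewrite GLN opprK.
suff /invP[_] : N x (s a n) by apply: (posN hPi).
have sE : s a n = 1 *: n + (- (2 * B n a)) *: a.
  by rewrite (root_reflE hPi _ ra) scale1r scaleNr.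
have [t0|t0] := leP (2 * B n a) 0.
  by rewrite sE; apply: (inv_comb hPi) => //; rewrite -?sE ?oppr_ge0.
apply: zx; apply/invP; split=> //.
have E : - (z^-1)%g (s a n) = 1 *: - (z^-1)%g n + (2 * B n a) *: (z^-1)%g a.
  by rewrite sE GLD !GLZ opprD !scale1r scaleNr opprK.
rewrite E; apply: pos_comb => //; first exact: ltW.
by rewrite -E; apply: (root_opp hPi); apply: root_act (weylV zW) rsn.
Qed.

(** The join of two elements below both [x] and [w] is again below both, so a longest
    such element is a greatest one. *)
Lemma exists_meet : exists y : GL V, [/\ W y, N y `<=` N x, N y `<=` N w
  & forall z, W z -> N z `<=` N x -> ~ N z a -> N z `<=` N y].
Proof.
pose P j := `[< exists z : GL V, [/\ W z, N z `<=` N x, N z `<=` N w & l z = j] >].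
have P0 : exists j, P j.
  exists 0%N; apply/asboolP; exists 1%g; split; last exact: len1.
  - exact: weyl1.
  - by move=> b /(inv1 hPi).
  - by move=> b /(inv1 hPi).
have Pb j : P j -> (j <= l x)%N by move=> /asboolP[z [zW zx _ <-]]; apply: len_inv_mono.
case: (ex_maxnP P0 Pb) => j /asboolP[y [yW yx yw <-]] ymax.
exists y; split=> // z zW zx za b zb; have zw := below_cover zW zx za.
apply: contrapT => yb; have [v [vW vE]] := bounded_join hPi xW yW zW yx zx.
have yv : N y `<=` N v by rewrite vE => c yc; apply: clo_sub; left.
have vb : N v b by rewrite vE; apply: clo_sub; right.
have := inv_lt hPi yW vW yv vb yb; rewrite ltnNge => /negP; apply; apply: ymax.
apply/asboolP; exists v; split=> //; rewrite vE.
  by apply: clo_min; [exact: inv_closed|move=> c [/yx|/zx]].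
by apply: clo_min; [exact: inv_closed|move=> c [/yw|/zw]].
Qed.

Context (y : GL V) (yW : W y) (yx : N y `<=` N x) (yw : N y `<=` N w).
Context (ymax : forall z, W z -> N z `<=` N x -> ~ N z a -> N z `<=` N y).

Let ya : ~ N y a. Proof. by move/yw. Qed.

(** The element reached just before [a] is created on the way from [y] up to [x] is
    still below [w], so it is [y]. *)
Lemma meet_last : exists2 t, Pi t & y t = a.
Proof.
have [r [t [rW tPi yr rx rt]]] := inv_crossing hPi yW xW yx xa ya.
have rtp : root t := root_simple tPi; have rtW := weylM rW (weyl_refl hPi rtp).
have nrt : pos (- r t) by rewrite rt opprK.
have [_ rP _] := inv_mulr_sup hPi rW tPi nrt.
have E : (r * s t)%g t = a.
  by rewrite GLME (refl_self (root_form1 hPi rtp)) GLN rt opprK.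
exists t => //; suff <- : (r * s t)%g = y by [].
have rta : ~ N (r * s t)%g a.
  by move=> /invP[_]; rewrite -E glVK; apply: (posN hPi); exact: pos_simple.
apply: (inv_set_inj hPi rtW yW); apply/seteqP; split.
  by apply: ymax => // b rb; apply: rx; apply/rP; left.
move=> b yb; case/rP: (yr _ yb) => //; rewrite rt opprK => ba.
by case: ya; rewrite -ba.
Qed.

Let top := (s a * y)%g.

Let topW : W top. Proof. exact: weylM. Qed.

Let topV b : (top^-1)%g b = (y^-1)%g (s a b).
Proof. by rewrite /top (invg_mull hPi _ ra). Qed.

Lemma meet_top : exists2 t, Pi t & (top = y * s t)%g.
Proof.
have [t tPi yt] := meet_last; exists t => //; rewrite /top -{1}yt.
by rewrite (weyl_refl_act hPi yW (root_simple tPi)) mulgVK.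
Qed.

Lemma inv_top b : N top b <-> N y b \/ b = a.
Proof.
have [t tPi yt] := meet_last; have := inv_mulr hPi yW tPi; rewrite yt => /(_ ap b).
suff -> : (y * s t)%g = top by [].
rewrite /top -{1}yt.
by rewrite (weyl_refl_act hPi yW (root_simple tPi)) mulgVK.
Qed.

Let topx : N top `<=` N x. Proof. by move=> b /inv_top[/yx|->]. Qed.

(** Otherwise [p * s k] would be below [x] without having the inversion [a], hence
    below the maximum [y]. *)
Let wall_below p k : W p -> N p `<=` N y -> Pi k -> pos (p k) -> N x (p k) ->
  ~ N y (p k) -> p k = a.
Proof.
move=> pW py kPi kp xk yk; apply: contrapT => ka; apply: yk.
have pP := inv_mulr hPi pW kPi kp.
apply: (ymax (z := (p * s k)%g)); last by apply/pP; right.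
- exact: weylM pW (weyl_simple kPi).
- by move=> b /pP[/py/yx|->].
- by move=> /pP[/py|/esym].
Qed.

(** The hypotheses of [walls_generate] hold because an inversion of [x] among the
    walls is equal to [a], and because [s a] maps inversions of [x] to roots
    that are negative for [w]. *)
Lemma coinv_meet : N' y = clo (N' x `|` [set a]).
Proof.
have clor : N' x `|` [set a] `<=` root by move=> b [[/pos_root]|->].
apply/seteqP; split; last first.
  apply: clo_min; first exact: coinv_closed.
  by move=> b [[bp xb]|->]; split=> // /yx.
have inG rho : N' y rho -> ~ clo (N' x `|` [set a]) rho -> N x rho /\ rho <> a.
  move=> [rhop _] Grho; split.
    by apply: contrapT => xrho; apply: Grho; apply: clo_sub; left.
  by move=> E; apply: Grho; rewrite E; apply: clo_sub; right.
have wallE p k : W p -> N p `<=` N y -> Pi k -> N' y (p k) -> N x (p k) -> p k = a.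
  by move=> pW py kPi [kp yk] xk; apply: wall_below.
apply: (walls_generate hPi yW (clo_closed clor)).
  move=> p k pW py kPi yk.
  have [xk|xk] := pselect (N x (p k)).
    by rewrite (wallE p k) //; apply: clo_sub; right.
  by apply: clo_sub; left; split=> //; case: yk.
move=> p k rho pW py kPi yk yrho /(inG _ yrho)[xrho rhoa] yn.
have [c c0 kE] := refl_neg_comb (inv_pos xrho) (proj1 yk) (inv_pos yn).
have xk : N x (p k).
  rewrite kE; apply: (inv_comb hPi); rewrite -?kE ?ltW //; first exact: yx.
  exact: pos_root (proj1 yk).
have ka := wallE p k pW py kPi yk xk; move: yn; rewrite ka => /yw/invP[_].
rewrite wV !GLN opprK sK => /(posN hPi); apply.
by case/invP: xrho.
Qed.

Let cov_roots : set V := (N' x `|` N' w) `\ a.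

Let cov_roots_root : cov_roots `<=` root.
Proof. by move=> b [[[/pos_root]|[/pos_root]]]. Qed.

(** The walls of the interval below [s a * y].  If [a] is an inversion of [p] then
    [s a * p] is below [y], and the wall [p k] is exchanged with [s a (p k)]. *)
Lemma top_wall p k : W p -> N p `<=` N top -> Pi k -> N' top (p k) ->
  N x (p k) -> N w (p k) -> False.
Proof.
move=> pW ptop kPi [kp topk] xk wk; have kW := weyl_simple (B := B) kPi.
have ka : p k <> a by move=> E; apply: topk; apply/inv_top; right.
have yk : ~ N y (p k) by move=> yk; apply: topk; apply/inv_top; left.
have [pa|pa] := pselect (N p a); last first.
  apply: ka; apply: wall_below => // b pb.
  case/inv_top: (ptop _ pb) => // ba.
  by case: pa; rewrite -ba.
pose q := (s a * p)%g; have qW : W q := weylM aW pW.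
have qV b : (q^-1)%g b = (p^-1)%g (s a b) by rewrite /q (invg_mull hPi _ ra).
have pVa := proj2 ((invP _ _).1 pa).
have nsa b : pos b -> s a b <> a.
  by move=> bp E; apply: (posN hPi bp); rewrite -(sK b) E aa opprK.
have qy : N q `<=` N y.
  move=> b /invP[bp]; rewrite qV => nb; have rb := pos_root bp.
  have rsb := root_refl hPi ra rb.
  case: (pos_or_neg hPi rsb) => sb.
    have /ptop/invP[_] : N p (s a b) by apply/invP.
    by rewrite topV sK => yb; apply/invP.
  have ba : b <> a by move=> E; move: nb; rewrite E aa GLN opprK => /(posN hPi); apply.
  suff /ptop/inv_top[//|/ba] : N p b by [].
  apply: contrapT => /(NinvP hPi pW bp) pb.
  have [c c0 aE] := refl_neg_comb bp ap sb.
  have E : (p^-1)%g a = c *: (p^-1)%g b + c *: - (p^-1)%g (s a b).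
    by rewrite {1}aE GLD !GLZ GLN.
  have : pos ((p^-1)%g a).
    by rewrite E; apply: pos_comb; rewrite -?E ?ltW //; exact: root_act (weylV pW) ra.
  by move/(posN hPi).
have qk : q k = s a (p k) by [].
have rsk := root_refl hPi ra (pos_root kp).
case: (pos_or_neg hPi rsk) => sk.
  have ysk : ~ N y (s a (p k)).
    by move=> /invP[_]; rewrite -topV => /(conj kp)/invP/topk.
  apply: (nsa _ kp); rewrite -qk; apply: wall_below; rewrite ?qk //.
  by apply/invP; split=> //; rewrite -wV; case/invP: wk.
have xsk : N x (- s a (p k)).
  apply: yx; apply/invP; split=> //; rewrite GLN opprK -topV.
  exact/(NinvP hPi topW kp).
move: (xsk) => /invP[_]; rewrite GLN -wV; case/invP: wk => _ nk.
by rewrite opprK => /(posN hPi); apply.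
Qed.

(** In the configuration excluded by [walls_generate], the inversion of [s a * y] is
    [a] itself, since a wall that is an inversion of [x] is not one of [w].  Then
    the root [rho] lies in the plane of [a] and the wall [kap], between [kap] and
    [s a kap]. *)
Lemma coinv_top : N' top = clo cov_roots.
Proof.
have topE b : N' top b <-> N' y b /\ b <> a.
  split=> [[bp tb]|[[bp yb] ba]]; last by split=> // /inv_top[].
  by do 2?split=> //; [move=> yb|move=> ba]; apply: tb; apply/inv_top; [left|right].
apply/seteqP; split; last first.
  apply: clo_min; first exact: coinv_closed.
  by move=> b [[[bp xb]|[bp wb]] ba]; apply/topE; split=> //; split=> //;
    [move/yx|move/yw].
have sub b : N' x b \/ N' w b -> b <> a -> clo cov_roots b.
  by move=> bN ba; apply: clo_sub.
have inG rho : N' top rho -> ~ clo cov_roots rho -> N x rho /\ N w rho.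
  move=> /topE[[rhop _] rhoa] Grho.
  by split; apply: contrapT => H; apply: Grho; apply: sub => //; [left|right].
have wall p k : W p -> N p `<=` N top -> Pi k -> N' top (p k) -> clo cov_roots (p k).
  move=> pW ptop kPi topk; apply: contrapT => /(inG _ topk)[xk wk].
  exact: (top_wall pW ptop kPi topk xk wk).
apply: (walls_generate hPi topW (clo_closed cov_roots_root)) => //.
move=> p k rho pW ptop kPi topk toprho Grho ytopn.
have [xrho wrho] := inG _ toprho Grho; have rhop := inv_pos xrho.
have kp := proj1 topk; have rk := pos_root kp; have Gk := wall _ _ pW ptop kPi topk.
have [c c0 kE] := refl_neg_comb rhop kp (inv_pos ytopn).
have xk : N x (p k).
  by rewrite kE; apply: (inv_comb hPi); rewrite -?kE ?ltW //; exact: topx.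
have wk : ~ N w (p k) by move=> wk; exact: (top_wall pW ptop kPi topk xk wk).
have [_ ka] := (topE _).1 topk.
have nE : - s (p k) rho = a.
  case/inv_top: ytopn => // /yw wn; case: wk.
  by rewrite kE; apply: (inv_comb hPi); rewrite -?kE ?ltW.
have rsk := root_refl hPi ra rk; have nk := (NinvP hPi wW kp).1 wk.
case: (pos_or_neg hPi rsk) => sk; last first.
  by apply: (swap xk ka); apply/invP; split=> //; rewrite GLN opprK -wV.
have ska : s a (p k) <> a.
  by move=> E; apply: (posN hPi kp); rewrite -(sK (p k)) E aa opprK.
have Gsk : clo cov_roots (s a (p k)).
  by apply: sub => //; left; apply/(coinvP hPi _ xW); rewrite -wV.
set kap := p k in kp rk Gk kE xk wk nE nk sk ska Gsk rsk ka *.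
pose d := 2 * B kap a.
have saE : s a kap = kap - d *: a by rewrite (root_reflE hPi _ ra).
have rhoE : rho = d *: kap - a.
  have E : rho = (2 * B rho kap) *: kap - a.
    by rewrite -nE opprK (root_reflE hPi _ rk) addrC subrK.
  have dE : B rho kap = 2 * B rho kap - B kap a.
    by rewrite {1}E !bformE (root_form1 hPi rk) (bformC a) mulr1.
  by rewrite E; congr (_ *: _ - _); rewrite /d; lra.
have d0 : 0 < d.
  rewrite ltNge; apply/negP => d0; apply: (posN hPi rhop).
  have F : - rho = 1 *: a + (- d) *: kap.
    by rewrite rhoE opprB scale1r scaleNr.
  rewrite F; apply: pos_comb => //; first by rewrite oppr_ge0.
  by rewrite -F; apply: (root_opp hPi); apply: pos_root.
have srho : s a rho = d *: kap + (1 - d * d) *: a.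
  rewrite rhoE GLB GLZ aa saE scalerBr scalerA opprK scalerBl scale1r.
  by rewrite -addrA (addrC (- _)).
(* Otherwise [s a rho] is a non-negative combination of [kap] and [a], which are
   not inversions of [w]. *)
have d1 : 1 < d.
  rewrite ltNge; apply/negP => d1; have dd : 0 <= 1 - d * d.
    by rewrite subr_ge0 mulr_ile1 // ltW.
  have : N' w (s a rho).
    rewrite srho; apply: (coinv_comb hPi) => //; rewrite -?srho ?ltW //.
    exact: (root_refl hPi ra (pos_root rhop)).
  move=> /(coinvP hPi _ wW)[_]; rewrite -xV => /(posN hPi); apply.
  by case/invP: xrho.
apply: Grho.
have F : rho = (d - d^-1) *: kap + d^-1 *: s a kap.
  rewrite rhoE saE scalerBr scalerA mulVf ?lt0r_neq0 // scale1r.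
  by rewrite scalerBl addrA subrK.
rewrite F; apply: clo_comb; rewrite -?F //.
- rewrite subr_ge0; apply: (@le_trans _ _ 1); last exact: ltW.
  by rewrite invf_le1 // ltW.
- by rewrite invr_ge0 ltW.
exact: pos_root.
Qed.

End Meet.

Lemma meet_theorem (x : GL V) (a : V) : cover (s a * x)%g a ->
  exists y : GL V,
    is_maximum B Pi [set z | [/\ W z, weak_le B Pi z x & ~ N z a]] y
    /\ is_meet B Pi x (s a * x)%g y
    /\ N' y = clo (N' x `|` [set a])
    /\ N' (s a * y)%g = N' y `\ a
    /\ N' y `\ a = clo ((N' x `|` N' (s a * x)%g) `\ a)
    /\ weak_lt B Pi y (s a * y)%g
    /\ exists2 t, Pi t & (s a * y = y * s t)%g.
Proof.
move=> cov; have [wW ap _] := cov; have ra := pos_root ap.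
have aW := weyl_refl hPi ra; have xW : W x by rewrite -[x](mulrgK hPi ra); apply: weylM.
have wa := cover_notin hPi cov.
have [y [yW yx yw ymax]] := exists_meet cov.
have ya : ~ N y a by move/yw.
have topP := inv_top cov yW yx yw ymax; have topW := weylM aW yW.
have topE : N' (s a * y)%g = N' y `\ a.
  apply/seteqP; split=> b.
    by move=> [bp tb]; do 2?split=> //; [move=> yb|move=> ba]; apply: tb; apply/topP; [left|right].
  by move=> [[bp yb] ba]; split=> // /topP[].
exists y; split.
  split; first by split=> //; apply/(weak_leP hPi yW xW).
  by move=> z [zW /(weak_leP hPi zW xW) zx za]; apply/(weak_leP hPi zW yW); exact: ymax.
split.
  split; first by split=> //; [apply/(weak_leP hPi yW xW)|apply/(weak_leP hPi yW wW)].
  move=> z [zW /(weak_leP hPi zW xW) zx /(weak_leP hPi zW wW) zw].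
  by apply/(weak_leP hPi zW yW); apply: ymax => // /zw.
split; first exact: (coinv_meet cov yW yx yw ymax).
split=> //.
split; first by rewrite -topE (coinv_top cov yW yx yw ymax).
split; last exact: (meet_top cov yW yx yw ymax).
split; first by apply/(weak_leP hPi yW topW) => b yb; apply/topP; left.
by move=> E; apply: ya; rewrite E; apply/topP; right.
Qed.

End Meets.

Theorem theorem1p8 (R : realType) (V : lmodType R) (B : {symmetric V})
    (Pi : set V) (hPi : simple_system B Pi)
    (x : GL V) (hx : weyl B Pi x) (a : V) (ha : pos_roots B Pi a) :
  (len B Pi (refl B a * x)%g = (len B Pi x + 1)%N ->
   (exists2 v, weyl B Pi v & inv_set B Pi x `|` [set a] `<=` inv_set B Pi v) ->
   exists y : GL V,
     is_minimum B Pi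
         [set z | [/\ weyl B Pi z, weak_le B Pi x z & inv_set B Pi z a]] y
     /\ is_join B Pi x (refl B a * x)%g y
     /\ root_closure B Pi (inv_set B Pi x `|` [set a]) = inv_set B Pi y
     /\ inv_set B Pi (refl B a * y)%g = inv_set B Pi y `\ a
     /\ inv_set B Pi y `\ a =
        root_closure B Pi
          ((inv_set B Pi x `|` inv_set B Pi (refl B a * x)%g) `\ a)
     /\ weak_lt B Pi (refl B a * y)%g y
     /\ exists2 t, Pi t & (refl B a * y = y * refl B t)%g)
  /\
  ((len B Pi (refl B a * x)%g + 1)%N = len B Pi x ->
   exists y : GL V,
     is_maximum B Pi
         [set z | [/\ weyl B Pi z, weak_le B Pi z x & ~ inv_set B Pi z a]] y
     /\ is_meet B Pi x (refl B a * x)%g y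
     /\ coinv_set B Pi y = root_closure B Pi (coinv_set B Pi x `|` [set a])
     /\ coinv_set B Pi (refl B a * y)%g = coinv_set B Pi y `\ a
     /\ coinv_set B Pi y `\ a =
        root_closure B Pi
          ((coinv_set B Pi x `|` coinv_set B Pi (refl B a * x)%g) `\ a)
     /\ weak_lt B Pi y (refl B a * y)%g
     /\ exists2 t, Pi t & (refl B a * y = y * refl B t)%g).
Proof.
have ra := pos_root ha; split=> [lx [v vW xav]|lx].
  apply: (join_theorem hPi _ vW xav); split=> //.
  by rewrite lx addn1.
apply: (meet_theorem hPi); split=> //; first exact: weylM (weyl_refl hPi ra) hx.
by rewrite (mulrgK hPi ra) -lx addn1.
Qed.
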